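(* Let $f:\mathbb{R}^d\to[0,\infty)$ be Lipschitz continuous with Lipschitz constant $L_f>0$, with unique global minimizer $x^*$ and $f^*=f(x^* )$, and suppose there exist positive constants $f_\infty,R_0,\nu,\mu$ such that $$\mu\|x-x^*\|\le(f(x)-f^* )^\nu\ \ \forall x\in\mathcal{B}_{R_0},\qquad f_\infty<f(x)-f^*\ \ \forall x\notin\mathcal{B}_{R_0}.$$ Let $\xi\in(0,1)$ be given. For any given $\varepsilon\in(0,\mathbb{E}[W_0])$, let $K$ and $K_\varepsilon$ be defined by $$K:=\sup\left\{k>0:\ \mathbb{E}[W_{k'}]>\varepsilon\ \text{and}\ \mathbb{E}\left[\|\bar x^{\star,k'}-x^*\|^2\right]\le C_{4,k'}^2,\ \forall k'\in[0,k)\right\},\qquad K_\varepsilon:=\left\lceil\log_{1/\gamma}\frac{\mathbb{E}[W_0]}{\varepsilon}\right\rceil,$$ and assume that the parameters $\{\lambda,\delta,\{\alpha_k\}_{k\ge0}\}$ in the ESCBO algorithm satisfy $$2\lambda-2\lambda^2-2\delta^2>0,\qquad 0<\gamma<1,\qquad\alpha_kM_g\le\kappa\sqrt{\varepsilon}\quad\forall k<K.$$ Then, if $\mathcal{I}^K_{r_K}$ is nonempty, there exists a $\beta_0>0$ such that for all $\beta>\beta_0$ the ESCBO algorithm satisfies $$\min_{k\in[0,K_\varepsilon]}\mathbb{E}[W_k]\le\varepsilon,$$ and it holds $\mathbb{E}[W_k]<\gamma^k\,\mathbb{E}[W_0]$ until $\mathbb{E}[W_k]$ reaches the prescribed accuracy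 $\varepsilon$.
   Context: $[N]=\{1,\dots,N\}$; $\|\cdot\|$ is the Euclidean norm; $\odot$ is the componentwise (Hadamard) product; $e_l$ is the $l$-th column of the identity matrix; $k$ and $k'$ range over integers. $\mathcal{B}_r=\{x\in\mathbb{R}^d:\|x-x^*\|\le r\}$, $f_r:=\max_{x\in\mathcal{B}_r}f(x)$, $\mathcal{I}^k_r:=\{i\in[N]:x^{i,k}\in\mathcal{B}_r\}$. Forward-difference gradient estimator with interval $\sigma>0$: $g(x)\in\mathbb{R}^d$ with $[g(x)]_l=\frac{f(x+\sigma e_l)-f(x)}{\sigma}$, $l\in[d]$. $M_g$ denotes a positive constant with $\|g(x)\|\le M_g$ for all $x$ (the paper takes $M_g=\sqrt d\,L_f$). ESCBO algorithm: given $N$, initial points $x^{i,0}\in\mathbb{R}^d$ ($i\in[N]$), parameters $\beta>0$, $\lambda>0$, $\delta\ge0$, $\sigma>0$ and a nonnegative sequence $\{\alpha_k\}_{k\ge0}$, for $k=0,1,2,\dots$ set $$\bar x^{\star,k}=\frac{\sum_{i=1}^N x^{i,k}\mathrm{e}^{-\beta f(x^{i,k})}}{\sum_{i=1}^N \mathrm{e}^{-\beta f(x^{i,k})}},$$ draw a random vector $\eta^k=(\eta^k_1,\dots,\eta^k_d)^\top$ with i.i.d. components $\eta^k_l\sim\mathcal{N}(0,\delta^2)$ (the same $\eta^k$ is used for all particles; $\eta^0,\eta^1,\dots$ are mutually independent), and for every $i\in[N]$ set $$y^{i,k+1}=x^{i,k}-\lambda(x^{i,k}-\bar x^{\star,k})-(x^{i,k}-\bar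 x^{\star,k})\odot\eta^k,\qquad x^{i,k+1}=y^{i,k+1}-\alpha_k\,g(x^{i,k}).$$ Mean square distance: $W_k=\frac1N\sum_{i=1}^N\|x^{i,k}-x^*\|^2$. For the given $\xi\in(0,1)$: $$\gamma:=1-(1-\xi)(2\lambda-2\lambda^2-2\delta^2),$$ $$\kappa:=\min\left\{\frac{\xi(2\lambda-2\lambda^2-2\delta^2)}{4\left(2\lambda^2+2\delta^2+\sqrt{\lambda^2+\delta^2}+1\right)},\ \sqrt{\frac{\xi(2\lambda-2\lambda^2-2\delta^2)}{2(2\lambda^2+2\delta^2+2)}}\right\},\qquad C_{4,k}:=\kappa\sqrt{\mathbb{E}[W_k]},$$ and for $k\ge0$ $$q_k:=\frac12\min\left\{f_\infty,\left(\frac{\mu C_{4,k}}{\sqrt2}\right)^{1/\nu}\right\},\qquad r_k:=\max\{s\in(0,R_0]:f_s-f^*\le q_k\}.$$ *)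

(* Defs.v *)
From HB Require Import structures.
From mathcomp Require Import all_boot all_order all_algebra.
From mathcomp Require Import all_classical all_reals all_analysis.

Set Implicit Arguments.
Unset Strict Implicit.
Unset Printing Implicit Defensive.

Import Order.TTheory GRing.Theory Num.Theory.
Import numFieldNormedType.Exports.

Local Open Scope classical_set_scope.
Local Open Scope ring_scope.

Section Geometry.
Context {R : realType} {d : nat}.
Implicit Types (f : 'rV[R]_d -> R) (x xs : 'rV[R]_d) (r : R).

(* The library norm on matrices is the sup norm, hence this definition. *)
Definition enorm x : R := Num.sqrt (\sum_(l < d) x 0 l ^+ 2).

Definition cball xs r : set 'rV[R]_d := [set x | enorm (x - xs) <= r].

(* Greatest element of A; the default 0 is only returned when there is none. *)
Definition set_max (A : set R) : R := xget 0 [set m | A m /\ ubound A m].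

Definition ball_max f xs r : R := set_max (f @` cball xs r).

Definition fd_grad f (sigma : R) x : 'rV[R]_d :=
  \row_l ((f (x + sigma *: delta_mx 0 l) - f x) / sigma).

Definition hadamard x y : 'rV[R]_d := map2_mx *%R x y.

End Geometry.

Section Algorithm.
Context {R : realType} {d N : nat}.
Implicit Types (f : 'rV[R]_d -> R) (X : 'I_N -> 'rV[R]_d) (xs : 'rV[R]_d).

Definition consensus f (beta : R) X : 'rV[R]_d :=
  (\sum_i expR (- beta * f (X i)))^-1 *: \sum_i expR (- beta * f (X i)) *: X i.

(* The iterates for a fixed realization x0 of the initial points and eta of the
   noise; the same vector eta k acts on all the particles. *)
Fixpoint escbo f (beta lambda sigma : R) (alpha : nat -> R)
    (x0 : 'I_N -> 'rV[R]_d) (eta : nat -> 'rV[R]_d) (k : nat) :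
    'I_N -> 'rV[R]_d :=
  if k is k'.+1 then
    let X := escbo f beta lambda sigma alpha x0 eta k' in
    let xbar := consensus f beta X in
    fun i =>
      let y := X i - lambda *: (X i - xbar) - hadamard (X i - xbar) (eta k') in
      y - alpha k' *: fd_grad f sigma (X i)
  else x0.

Definition mean_sqdist xs X : R := N%:R^-1 * \sum_i enorm (X i - xs) ^+ 2.

Definition particles_in_ball xs (r : R) X : set 'I_N :=
  [set i | cball xs r (X i)].

End Algorithm.

Section Constants.
Context {R : realType}.
Implicit Types xi lambda delta : R.

Definition gap lambda delta : R :=
  2 * lambda - 2 * lambda ^+ 2 - 2 * delta ^+ 2.

Definition rate xi lambda delta : R := 1 - (1 - xi) * gap lambda delta.

Definition kappa xi lambda delta : R :=
  Num.min
    (xi * gap lambda delta /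
      (4 * (2 * lambda ^+ 2 + 2 * delta ^+ 2
            + Num.sqrt (lambda ^+ 2 + delta ^+ 2) + 1)))
    (Num.sqrt (xi * gap lambda delta /
      (2 * (2 * lambda ^+ 2 + 2 * delta ^+ 2 + 2)))).

Definition q_level (finf mu nu C4 : R) : R :=
  2^-1 * Num.min finf ((mu * C4 / Num.sqrt 2) `^ nu^-1).

Definition r_radius d (f : 'rV[R]_d -> R) (xs : 'rV[R]_d) (R0 q : R) : R :=
  set_max [set s | 0 < s <= R0 /\ ball_max f xs s - f xs <= q].

(* The horizon K, where EW k stands for E[W_k] and EX k for
   E[|xbar^k - x*|^2].  The supremum is taken in [0, +oo]: it is 0 when no
   k > 0 qualifies (ereal_sup alone would give -oo). *)
Definition horizon (eps : R) (C4 : nat -> R) (EW EX : nat -> \bar R) : \bar R :=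
  maxe 0%E (ereal_sup [set (k%:R : R)%:E | k in [set k : nat | (0 < k)%N /\
    forall k', (k' < k)%N ->
      (eps%:E < EW k')%E /\ (EX k' <= (C4 k' ^+ 2)%:E)%E]]).

Definition log_base (b x : R) : R := ln x / ln b.

(* Only used when gamma and eps / EW0 are in ]0, 1[; the ceiling is then
   positive and the absolute value merely casts it to nat. *)
Definition K_eps (gamma EW0 eps : R) : nat :=
  `|Num.ceil (log_base gamma^-1 (EW0 / eps))|%N.

End Constants.

Section Probability.
Context {disp : measure_display} {T : measurableType disp} {R : realType}.
Variable P : probability T R.

(* normal_prob takes the standard deviation, and for the value 0 it is the
   uniform law on [0, 1]; N(0, 0) is the point mass at 0. *)
Definition centered_gauss (delta : R) (A : set R) : \bar R :=
  if delta == 0 then \d_(0 : R) A else normal_prob 0 delta A.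

Definition mutually_independent (I : eqType) (X : I -> {RV P >-> R}) : Prop :=
  forall (s : seq I) (B : I -> set R), uniq s ->
    (forall i, i \in s -> measurable (B i)) ->
    P (\bigcap_(i in [set` s]) (X i @^-1` B i)) =
    (\big[*%E/1%E]_(i <- s) P (X i @^-1` B i))%E.

Definition sigma_family (I : Type) (X : I -> {RV P >-> R}) : set (set T) :=
  <<s \bigcup_(i in [set: I]) preimage_set_system [set: T] (X i) measurable >>.

Definition independent_systems (F G : set (set T)) : Prop :=
  forall A B, F A -> G B -> P (A `&` B) = (P A * P B)%E.

End Probability.

(* Main.v *)
(* The consensus point at step k is controlled by a quantitative Laplace
   principle: once some particle has f <= f* + q, every particle with
   f > f* + 2q carries weight at most exp(-beta q), while those below this level
   are within C4/sqrt 2 of x* by the growth condition.  Jensen's inequality then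
   gives E|xbar - x*|^2 <= C4^2/2 + N exp(-beta q) E[W].  As long as E[W] > eps,
   q is bounded below by a constant that does not depend on beta, so one beta0
   works for every possible value of the horizon K.

   On the other hand, if E|xbar - x*|^2 <= C4^2 and alpha_k Mg <= kappa sqrt eps,
   then E[W_(k+1)] < gamma E[W_k]: the noise at step k is centered, has second
   moment at most delta^2 and is independent of the past, and the remaining cross
   terms are split coordinatewise by Young's inequality with weight kappa.  So if
   the horizon ended at some k with E[W_k] > eps, the Laplace estimate would
   contradict the maximality of k. *)
Require Import Defs.
From HB Require Import structures.
From mathcomp Require Import all_boot all_order all_algebra.
From mathcomp Require Import all_classical all_reals all_analysis.
From mathcomp Require Import measurable_realfun ring lra.

Set Implicit Arguments.
Unset Strict Implicit.
Unset Printing Implicit Defensive.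

Import Order.TTheory GRing.Theory Num.Theory.
Import numFieldNormedType.Exports.

Local Open Scope classical_set_scope.
Local Open Scope ring_scope.

(** * First two moments of the centered normal law *)

Section gauss_moments.
Variables (R : realType) (s : R).
Hypothesis s_neq0 : s != 0.
Local Notation mu := (@lebesgue_measure R).
Local Notation phi := (normal_pdf 0 s).
Local Notation symitv n := (`[(- n.+1%:R : R)%R, n.+1%:R%R]%classic).

(** This differential equation makes [s ^+ 2 * x * phi x] and [- s ^+ 2 * phi x] explicit
    antiderivatives for the two moment computations below. *)
Lemma is_derive_normal_pdf (x : R) :
  is_derive x 1 phi (- (x / s ^+ 2) * phi x).
Proof.
rewrite normal_pdfE//.
pose c : R := - (s ^+ 2 *+ 2)^-1.
have -> : (fun x => normal_peak s * normal_fun 0 s x) =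
    normal_peak s \*: (expR \o (c \*: (@id R ^+ 2))).
  apply/funext => y; rewrite /normal_fun subr0 /= /GRing.scale/=.
  by congr (_ * expR _); rewrite /c mulrC mulrN mulNr.
have dq : is_derive x 1 (c \*: (@id R ^+ 2)) (- (x / s ^+ 2)).
  apply: is_derive_eq; rewrite /GRing.scale/= expr1 mulr1 /c.
  by field.
have de := @is_derive1_comp R expR _ x _ _ (is_derive_expR _) dq.
apply: is_derive_eq; rewrite /GRing.scale/= mulrA mulrC; congr (_ * (_ * _)).
by rewrite /normal_fun subr0 /= /GRing.scale/= /c mulrC mulrN mulNr.
Qed.

(** The Radon-Nikodym derivative of the normal law is almost everywhere [phi], since both have the
    same integral over every measurable set. *)
Lemma integral_normal_prob (g : R -> \bar R) : (forall x, (0 <= g x)%E) ->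
  measurable_fun [set: R] g ->
  (\int[normal_prob 0 s]_x g x = \int[mu]_x (g x * (phi x)%:E))%E.
Proof.
move=> g0 mg.
have dom := @normal_prob_dominates R 0 s.
rewrite -(Radon_Nikodym_SigmaFinite.change_of_variables dom)//.
apply: ae_eq_integral => //.
- apply: emeasurable_funM => //.
  exact: measurable_int (Radon_Nikodym_SigmaFinite.f_integrable dom).
- apply: emeasurable_funM => //; apply/measurable_EFinP.
  exact: measurable_normal_pdf.
- apply: ae_eqe_mul2l.
  apply: integral_ae_eq => //.
  + exact: Radon_Nikodym_SigmaFinite.f_integrable.
  + by apply/measurable_EFinP; exact: measurable_normal_pdf.
  + by move=> E _ mE; rewrite -Radon_Nikodym_SigmaFinite.f_integral.
Qed.

Lemma continuous_FTC2_itv (f F : R -> R) (n : nat) : continuous f ->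
  (forall x : R, is_derive x 1 F (f x)) ->
  (\int[mu]_(x in symitv n) (f x)%:E
   = (F n.+1%:R)%:E - (F (- n.+1%:R)%R)%:E)%E.
Proof.
move=> cf dF; apply: continuous_FTC2.
- by rewrite gtrN.
- exact: continuous_subspaceT.
- have cF : continuous F.
    by move=> x; apply: differentiable_continuous; apply/derivable1_diffP; case: (dF x).
  split; first by move=> x _; case: (dF x).
  + exact/cvg_at_right_filter/cF.
  + exact/cvg_at_left_filter/cF.
- by move=> x _; rewrite derive1E; case: (dF x).
Qed.

(** Monotone convergence along symmetric intervals exhausting the line. *)
Lemma cvg_integral_symitv (f : R -> \bar R) : measurable_fun [set: R] f ->
  (forall x, (0 <= f x)%E) ->
  (\int[mu]_(x in symitv n) f x @[n --> \oo] --> \int[mu]_x f x)%E.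
Proof.
move=> mf f0.
have -> : [set: R] = \bigcup_n symitv n.
  apply/esym; rewrite -subTset => x _.
  exists (Num.truncn `|x|) => //=; rewrite in_itv/= -ler_norml ltW//.
  exact: truncnS_gt.
apply: ge0_nondecreasing_set_cvg_integral => //.
- apply/nondecreasing_seqP => n; apply/subsetPset => x /=.
  rewrite !in_itv/= -!ler_norml => /le_trans; apply.
  by rewrite ler_nat.
- by move=> n; exact: measurable_funTS.
Qed.

(** Integration by parts on a symmetric interval: [s ^+ 2 * x * phi x] has nonnegative increment
    there, so the integral of [x ^+ 2 * phi x] is at most [s ^+ 2] times that of [phi]. An upper
    bound is enough for the descent estimate, and it avoids the limit of the boundary terms. *)
Lemma normal_second_moment :
  (\int[normal_prob 0 s]_x (x ^+ 2)%:E <= (s ^+ 2)%:E)%E.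
Proof.
have cphi := @continuous_normal_pdf R 0 s s_neq0.
have cX2phi : continuous (fun x : R => x ^+ 2 * phi x).
  by move=> x; apply: cvgM; [exact: exprn_continuous|exact: cphi].
have mX2phi : measurable_fun [set: R] (fun x : R => x ^+ 2 * phi x).
  exact: continuous_measurable_fun.
rewrite integral_normal_prob; last 2 first.
- by move=> x; rewrite lee_fin sqr_ge0.
- exact/measurable_EFinP/measurable_funX.
under eq_integral do rewrite -EFinM.
have dF (x : R) : is_derive x 1 (s ^+ 2 \*: (@id R * phi))
    (s ^+ 2 * phi x - x ^+ 2 * phi x).
  have dphi := is_derive_normal_pdf x.
  by apply: is_derive_eq; rewrite /GRing.scale/=; field.
have cs2phi : continuous (fun x => s ^+ 2 * phi x).
  by move=> x; apply: cvgM; [exact: cvg_cst|exact: cphi].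
have cf : continuous (fun x => s ^+ 2 * phi x - x ^+ 2 * phi x).
  by move=> x; apply: (@cvgB _ R^o); [exact: cs2phi|exact: cX2phi].
apply: (cvge_to_le (cvg_integral_symitv _ _)).
- exact/measurable_EFinP.
- by move=> x; rewrite lee_fin mulr_ge0 ?sqr_ge0 ?normal_pdf_ge0.
apply: nearW => n.
have itg (g : R -> R) : continuous g ->
    mu.-integrable (symitv n) (EFin \o g).
  move=> cg; apply: continuous_compact_integrable; first exact: segment_compact.
  exact: continuous_subspaceT.
have := continuous_FTC2_itv n cf dF.
rewrite -EFinB.
under eq_integral do rewrite EFinB.
rewrite integralB//=; [|exact: itg..].
have -> : (\int[mu]_(x in symitv n) (s ^+ 2 * phi x)%:E =
    (s ^+ 2)%:E * \int[mu]_(x in symitv n) (phi x)%:E)%E.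
  by rewrite -integralZl//; exact: itg.
have Ile : (\int[mu]_(x in symitv n) (phi x)%:E <= 1)%E.
  rewrite -(integral_normal_pdf 0 s); apply: ge0_subset_integral => //.
  - by apply/measurable_EFinP; exact: measurable_normal_pdf.
  - by move=> x _; rewrite lee_fin normal_pdf_ge0.
have I0 : (0 <= \int[mu]_(x in symitv n) (phi x)%:E)%E.
  by apply: integral_ge0 => x _; rewrite lee_fin normal_pdf_ge0.
have J0 : (0 <= \int[mu]_(x in symitv n) (x ^+ 2 * phi x)%:E)%E.
  by apply: integral_ge0 => x _; rewrite lee_fin mulr_ge0 ?sqr_ge0 ?normal_pdf_ge0.
have : (\int[mu]_(x in symitv n) (x ^+ 2 * phi x)%:E)%E \is a fin_num.
  exact: (integrable_fin_num _ (itg _ cX2phi)).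
move: (\int[mu]_(x in _) (x ^+ 2 * phi x)%:E)%E J0 => [J| |]//.
move: (\int[mu]_(x in _) (phi x)%:E)%E I0 Ile => [I| |]//.
rewrite !lee_fin => I0 I1 J0 _ [].
have p1 := normal_pdf_ge0 0 s n.+1%:R.
have p2 := normal_pdf_ge0 0 s (- n.+1%:R).
have n0 : (0 : R) <= n.+1%:R by [].
have s0 : 0 <= s ^+ 2 by rewrite sqr_ge0.
set p := phi _ in p1 *; set p' := phi _ in p2 *; set t := s ^+ 2 in s0 *.
have h1 := mulr_ge0 s0 (mulr_ge0 n0 p1).
have h2 := mulr_ge0 s0 (mulr_ge0 n0 p2).
have h3 : t * I <= t by rewrite ler_piMr.
move=> e; have {}e : t * I - J = t * (n.+1%:R * p) - t * (- n.+1%:R * p') := e.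
lra.
Qed.

(** The antiderivative [- s ^+ 2 * phi x] is even, so positive and negative parts of [x * phi x]
    have equal integrals on every symmetric interval, hence on the line. *)
Lemma normal_first_moment : (\int[normal_prob 0 s]_x x%:E = 0)%E.
Proof.
have cphi := @continuous_normal_pdf R 0 s s_neq0.
have cXphi : continuous (fun x : R => x * phi x).
  by move=> x; apply: cvgM; [exact: cvg_id|exact: cphi].
have dF (x : R) : is_derive x 1 ((- s ^+ 2) \*: phi) (x * phi x).
  have dphi := is_derive_normal_pdf x.
  by apply: is_derive_eq; rewrite /GRing.scale/=; field.
have phi_even x : phi (- x) = phi x.
  by rewrite normal_pdfE// /normal_fun !subr0 sqrrN.
have mEFin : measurable_fun [set: R] (@EFin R).
  exact/measurable_EFinP.
have mf : measurable_fun [set: R] (fun x => (x * phi x)%:E).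
  by apply/measurable_EFinP; exact: continuous_measurable_fun.
(* Finiteness, from the second moment and [x^- <= 1 + x ^+ 2], ensures that the final difference of
   the two parts is not [+oo - +oo]. *)
have fin : (\int[normal_prob 0 s]_x (@EFin R)^\- x < +oo)%E.
  apply: (@le_lt_trans _ _ (\int[normal_prob 0 s]_x (1 + (x ^+ 2)%:E))%E).
    apply: ge0_le_integral => //=; first exact: measurable_funeneg.
    - apply: emeasurable_funD => //.
      by apply/measurable_EFinP; exact: measurable_funX.
    - move=> x _; rewrite funenegE -EFin_max lee_fin ge_max.
      by apply/andP; split; nra.
  rewrite ge0_integralD//=; last 2 first.
    by move=> x _; rewrite lee_fin sqr_ge0.
    by apply/measurable_EFinP; exact: measurable_funX.
  rewrite integral_cst//= probability_setT mule1 lte_add_pinfty ?ltry//.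
  exact: le_lt_trans normal_second_moment (ltry _).
have eqp x : (((@EFin R)^\+ x * (phi x)%:E) = (fun x => (x * phi x)%:E)^\+ x)%E.
  rewrite !funeposE -!EFin_max -EFinM maxr_pMl ?normal_pdf_ge0//.
  by rewrite mul0r.
have eqn x : (((@EFin R)^\- x * (phi x)%:E) = (fun x => (x * phi x)%:E)^\- x)%E.
  rewrite !funenegE -!EFin_max -EFinM maxr_pMl ?normal_pdf_ge0//.
  by rewrite mul0r mulNr.
have Ep : (\int[normal_prob 0 s]_x (@EFin R)^\+ x =
    \int[mu]_x (fun x => (x * phi x)%:E)^\+ x)%E.
  rewrite integral_normal_prob//; last exact: measurable_funepos.
  by apply: eq_integral => x _; exact: eqp.
have En : (\int[normal_prob 0 s]_x (@EFin R)^\- x =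
    \int[mu]_x (fun x => (x * phi x)%:E)^\- x)%E.
  rewrite integral_normal_prob//; last exact: measurable_funeneg.
  by apply: eq_integral => x _; exact: eqn.
rewrite En in fin; rewrite integralE Ep En.
suff -> : (\int[mu]_x (fun x => (x * phi x)%:E)^\+ x =
    \int[mu]_x (fun x => (x * phi x)%:E)^\- x)%E.
  by rewrite subee// ge0_fin_numE// integral_ge0.
apply: (cvg_unique _ (cvg_integral_symitv _ _)) => //=.
  exact: measurable_funepos.
under eq_fun => n.
  have : (\int[mu]_(x in symitv n) (fun x => (x * phi x)%:E)^\+ x =
    \int[mu]_(x in symitv n) (fun x => (x * phi x)%:E)^\- x)%E.
    have itf : mu.-integrable (symitv n) (fun x => (x * phi x)%:E).
      apply: continuous_compact_integrable; first exact: segment_compact.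
      exact: continuous_subspaceT.
    have := continuous_FTC2_itv n cXphi dF.
    rewrite /GRing.scale/= phi_even subee// integralE => /eqP.
    have := integrable_fin_num _ (integrable_funeneg _ itf).
    have := integrable_fin_num _ (integrable_funepos _ itf).
    do 2 move=> /(_ (measurable_itv _)).
    move: (\int[mu]_(x in _) _)%E => [a| |]//.
    move: (\int[mu]_(x in _) _)%E => [b| |]// _ _.
    by rewrite -EFinB eqe subr_eq0 => /eqP ->.
  move=> ->; over.
by apply: cvg_integral_symitv => //; exact: measurable_funeneg.
Qed.
End gauss_moments.

(** Packages a function as a random variable so that its distribution can be formed. *)
Lemma measurable_fun_RV {disp disp' : measure_display}
    {T : measurableType disp} {T' : measurableType disp'} {R : realType}
    (P : probability T R) (U : T -> T') :
  measurable_fun setT U -> exists X : {RV P >-> T'}, X = U :> (T -> T').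
Proof.
move=> mU; pose mixin := isMeasurableFun.Build _ _ _ _ U mU.
by exists (HB.pack_for {mfun T >-> T'} U mixin).
Qed.

(** * Moments of the noise variables, including the degenerate case [delta = 0] *)

Section centered_gauss_moments.
Context {disp : measure_display} {T : measurableType disp} {R : realType}.
Variables (P : probability T R) (X : {RV P >-> R}) (delta : R).
Hypothesis X_law : forall A, measurable A ->
  distribution P X A = centered_gauss delta A.

(* [normal_prob] lives on [measurableTypeR R], which has the same measurable
   sets as [R] but another display: hence the detour through X'. *)
Let exX' : exists2 X' : {RV P >-> measurableTypeR R}, X' = X :> (T -> R) &
  forall A : set (measurableTypeR R), measurable A ->
    distribution P X' A = centered_gauss delta A.
Proof.
have mX : measurable_fun setT (X : T -> measurableTypeR R).
  exact: (measurable_funPT X).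
have [X' XE] := measurable_fun_RV P mX.
exists X' => // A mA; change (P (X' @^-1` A) = centered_gauss delta A).
by rewrite XE; exact: X_law.
Qed.

Lemma centered_gauss_second_moment :
  (\int[P]_w (X w ^+ 2)%:E <= (delta ^+ 2)%:E)%E.
Proof.
have [X' XE X'_law] := exX'.
have -> : (\int[P]_w (X w ^+ 2)%:E = \int[distribution P X']_x (x ^+ 2)%:E)%E.
  rewrite ge0_integral_distribution//; first by rewrite XE.
  - by apply/measurable_EFinP; exact: measurable_funX.
  - by move=> x; rewrite lee_fin sqr_ge0.
(* For [delta = 0] the law is the point mass at 0, and the normal computation does not apply. *)
have [d0|d0] := eqVneq delta 0.
  rewrite (eq_measure_integral (@dirac _ (measurableTypeR R) (0 : R) R)); last first.
    move=> A mA _; apply: etrans (X'_law _ mA) _.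
    by rewrite /centered_gauss d0 eqxx.
  by rewrite integral_dirac//= ?diracT ?mul1e ?d0//; apply/measurable_EFinP; exact: measurable_funX.
rewrite (eq_measure_integral (normal_prob 0 delta)); last first.
  move=> A mA _; apply: etrans (X'_law _ mA) _.
  by rewrite /centered_gauss (negbTE d0).
exact: normal_second_moment.
Qed.

Lemma centered_gauss_integrable_sqr :
  P.-integrable setT (fun w => (X w ^+ 2)%:E).
Proof.
apply/integrableP; split.
  by apply/measurable_EFinP; exact: measurable_funX.
under eq_integral do rewrite gee0_abs ?lee_fin ?sqr_ge0//.
exact: le_lt_trans centered_gauss_second_moment (ltry _).
Qed.

Lemma centered_gauss_integrable : P.-integrable setT (EFin \o X).
Proof.
apply: (@le_integrable _ _ _ P _ _ _ (fun w => 1%:E + (X w ^+ 2)%:E)%E) => //.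
- exact/measurable_EFinP.
- move=> w _; rewrite -EFinD !abse_EFin lee_fin [leRHS]ger0_norm; last first.
    by rewrite addr_ge0 ?sqr_ge0.
  by rewrite ler_norml; apply/andP; split; nra.
- apply: integrableD => //; last exact: centered_gauss_integrable_sqr.
  exact: finite_measure_integrable_cst.
Qed.

Lemma centered_gauss_mean : (\int[P]_w (X w)%:E = 0)%E.
Proof.
have [X' XE X'_law] := exX'.
have := centered_gauss_integrable.
rewrite -XE => iX.
have -> : (\int[P]_w (X' w)%:E = \int[distribution P X']_x x%:E)%E.
  by rewrite integral_distribution//; exact/measurable_EFinP.
have [d0|d0] := eqVneq delta 0.
  rewrite (eq_measure_integral (@dirac _ (measurableTypeR R) (0 : R) R)); last first.
    move=> A mA _; apply: etrans (X'_law _ mA) _.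
    by rewrite /centered_gauss d0 eqxx.
  by rewrite integral_dirac//= ?diracT ?mul1e//; exact/measurable_EFinP.
rewrite (eq_measure_integral (normal_prob 0 delta)); last first.
  move=> A mA _; apply: etrans (X'_law _ mA) _.
  by rewrite /centered_gauss (negbTE d0).
exact: normal_first_moment.
Qed.
End centered_gauss_moments.

(** * Expectation of a product of independent variables *)

Section independent_product.
Context {disp : measure_display} {T : measurableType disp} {R : realType}.
Variables (P : probability T R) (U V : T -> R).
Hypotheses (mU : measurable_fun setT U) (mV : measurable_fun setT V).
Hypothesis indepUV : forall A B : set R, measurable A -> measurable B ->
  P (U @^-1` A `&` V @^-1` B) = (P (U @^-1` A) * P (V @^-1` B))%E.
Hypotheses (iU : P.-integrable setT (EFin \o U))
           (iV : P.-integrable setT (EFin \o V)).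

(** The joint law of [U] and [V] is the product of their laws; Tonelli gives integrability of the
    product and Fubini factors the integral. *)
Lemma independent_integralM :
  P.-integrable setT (fun w => (U w * V w)%:E) /\
  (\int[P]_w (U w * V w)%:E = \int[P]_w (U w)%:E * \int[P]_w (V w)%:E)%E.
Proof.
have [X XE] := measurable_fun_RV P mU.
have [Y YE] := measurable_fun_RV P mV.
have [Z ZE] := measurable_fun_RV P (measurable_fun_pair mU mV).
pose m1 := distribution P X; pose m2 := distribution P Y.
(* Independence is agreement of the two measures on rectangles, which determines the product
   measure. *)
have m12 C : measurable C -> (m1 \x m2)%E C = distribution P Z C.
  move=> mC; apply: product_measure_unique => // A B mA mB.
  rewrite /m1 /m2; change (P (Z @^-1` (A `*` B)) =
    (P (X @^-1` A) * P (Y @^-1` B))%E).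
  by rewrite XE YE ZE -indepUV.
pose h (p : R * R) : \bar R := (p.1 * p.2)%:E.
have mh : measurable_fun setT h.
  by apply/measurable_EFinP; apply: measurable_funM.
have iX : m1.-integrable setT EFin.
  apply/integrableP; split; first exact/measurable_EFinP.
  have /integrableP[_] := iU.
  rewrite ge0_integral_distribution// ?XE//.
  by apply: measurableT_comp => //; exact/measurable_EFinP.
have iY : m2.-integrable setT EFin.
  apply/integrableP; split; first exact/measurable_EFinP.
  have /integrableP[_] := iV.
  rewrite ge0_integral_distribution// ?YE//.
  by apply: measurableT_comp => //; exact/measurable_EFinP.
have ih : (m1 \x m2)%E.-integrable setT h.
  apply/integrable12ltyP => //.
  have /integrableP[_ iY'] := iY; have /integrableP[mabs iX'] := iX.
  have E x : (\int[m2]_y `|h (x, y)| = `|x%:E| * \int[m2]_y `|y%:E|)%E.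
    rewrite -ge0_integralZl//; last first.
      by apply: measurableT_comp => //; exact/measurable_EFinP.
    by apply: eq_integral => y _; rewrite /h/= normrM.
  under eq_integral do rewrite E.
  rewrite ge0_integralZr//; last by exact: integral_ge0.
    by rewrite lte_mul_pinfty// ?integral_ge0// ge0_fin_numE// integral_ge0.
  by apply: measurableT_comp.
have iUV : P.-integrable setT (fun w => (U w * V w)%:E).
  apply/integrableP; split.
    by apply/measurable_EFinP; exact: measurable_funM.
  have /integrableP[_] := ih.
  rewrite (@eq_measure_integral _ _ _ _ (distribution P Z)); last first.
    by move=> A mA _; exact: m12.
  rewrite ge0_integral_distribution// ?ZE//.
  by apply: measurableT_comp.
split => //.
transitivity (\int[distribution P Z]_z h z)%E.
  rewrite integral_distribution//; last by rewrite ZE.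
  by rewrite ZE.
transitivity (\int[m1 \x m2]_z h z)%E.
  by apply/esym; apply: eq_measure_integral => A mA _; exact: m12.
rewrite -integral12_prod_meas1//.
have -> : (\int[P]_w (U w)%:E = \int[m1]_x x%:E)%E.
  by rewrite integral_distribution// ?XE//; exact/measurable_EFinP.
have -> : (\int[P]_w (V w)%:E = \int[m2]_x x%:E)%E.
  by rewrite integral_distribution// ?YE//; exact/measurable_EFinP.
have E x : fubini_F m2 h x = (x%:E * \int[m2]_y y%:E)%E.
  by rewrite -integralZl.
under eq_integral do rewrite E.
have /fineK <- := integrable_fin_num measurableT iY.
by rewrite integralZr.
Qed.
End independent_product.

(** * Independence of the current noise from the past *)

Section past_independence.
Context {disp : measure_display} {T : measurableType disp} {R : realType}.
Variables (P : probability T R) (I : Type) (d : nat).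
Variables (x0 : I -> {RV P >-> R}) (eta : nat -> 'I_d -> {RV P >-> R}).
Hypothesis eta_indep : mutually_independent (fun kl : nat * 'I_d => eta kl.1 kl.2).
Hypothesis x0_eta_indep : independent_systems P (sigma_family x0)
  (sigma_family (fun kl : nat * 'I_d => eta kl.1 kl.2)).

Definition past_indices (k : nat) : seq (nat * 'I_d) :=
  [seq (j, l) | j <- iota 0 k, l <- enum 'I_d].

Definition noise_cylinder (s : seq (nat * 'I_d)) (B : nat * 'I_d -> set R) : set T :=
  \bigcap_(i in [set` s]) (eta i.1 i.2 @^-1` B i).

(* A pi-system generating the sigma-algebra of the initial points and of the
   first k noise vectors. *)
Definition past_pi_system (k : nat) : set (set T) :=
  [set A | exists A0 B, [/\ sigma_family x0 A0, forall i, measurable (B i) &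
     A = A0 `&` noise_cylinder (past_indices k) B]].

Lemma mem_past_indices k j l : ((j, l) \in past_indices k) = (j < k)%N.
Proof.
apply/allpairsP/idP => [[[a b] /= [+ _ [-> _]]]|jk].
  by rewrite mem_iota.
by exists (j, l); split => //=; [rewrite mem_iota|rewrite mem_enum].
Qed.

Lemma uniq_past_indices k : uniq (past_indices k).
Proof.
apply: allpairs_uniq; [exact: iota_uniq|exact: enum_uniq|].
by move=> [a b] [a' b'] _ _ [-> ->].
Qed.

Lemma sigma_family_preimage (J : Type) (X : J -> {RV P >-> R}) i (B : set R) :
  measurable B -> sigma_family X (X i @^-1` B).
Proof.
move=> mB; apply: sub_sigma_algebra; exists i => //.
by exists B => //; rewrite setTI.
Qed.

Lemma sigma_family_measurable (J : Type) (X : J -> {RV P >-> R}) :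
  sigma_family X `<=` measurable.
Proof.
rewrite /sigma_family.
apply: (smallest_sub (@sigma_algebra_measurable _ T)).
by move=> _ [i _ [B mB <-]]; exact: measurable_funPT.
Qed.

Lemma noise_cylinder_sigma_family s B : (forall i, measurable (B i)) ->
  sigma_family (fun kl : nat * 'I_d => eta kl.1 kl.2) (noise_cylinder s B).
Proof.
move=> mB; rewrite /noise_cylinder.
pose G := \bigcup_(i in [set: nat * 'I_d])
  preimage_set_system [set: T] (eta i.1 i.2) measurable.
(* Equipping [T] with the generated sigma-algebra turns membership into measurability, so that the
   closure lemmas apply. *)
change (measurable (noise_cylinder s B : set (g_sigma_algebraType G))).
apply: fin_bigcap_measurable; first exact: finite_seq.
move=> i _; change (sigma_family (fun kl : nat * 'I_d => eta kl.1 kl.2)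
  (eta i.1 i.2 @^-1` B i)).
exact: (@sigma_family_preimage _ (fun kl : nat * 'I_d => eta kl.1 kl.2) i _ (mB i)).
Qed.

Lemma past_pi_systemI k : setI_closed (past_pi_system k).
Proof.
move=> _ _ [A [B [sA mB ->]]] [A' [B' [sA' mB' ->]]].
exists (A `&` A'), (fun i => B i `&` B' i); split.
- exact: (@measurableI _ (g_sigma_algebraType _)).
- by move=> i; exact: measurableI.
- rewrite setIACA; congr (_ `&` _).
  by rewrite /noise_cylinder -bigcapI; apply: eq_bigcapr => i _; rewrite preimage_setI.
Qed.

Lemma past_measurable_x0 k i : measurable_fun
  [set: g_sigma_algebraType (past_pi_system k)] (x0 i : T -> R).
Proof.
move=> _ B mB; rewrite setTI; apply: sub_sigma_algebra.
exists (x0 i @^-1` B), (fun=> setT); split => //.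
  exact: sigma_family_preimage.
apply/seteqP; split => [w xw|w []//]; split => //.
Qed.

Lemma past_measurable_eta k j l : (j < k)%N -> measurable_fun
  [set: g_sigma_algebraType (past_pi_system k)] (eta j l : T -> R).
Proof.
move=> jk _ B mB; rewrite setTI; apply: sub_sigma_algebra.
exists setT, (fun i => if i == (j, l) then B else setT); split => //.
- exact: (@measurableT _ (g_sigma_algebraType _)).
- by move=> i; case: ifP.
- rewrite setTI /noise_cylinder; apply/seteqP; split => w /=.
    by move=> Bw i _ /=; case: ifP => // /eqP ->.
  move=> /(_ (j, l)) /=; rewrite eqxx; apply.
  by rewrite mem_past_indices.
Qed.

Lemma past_pi_system_measurable k : <<s past_pi_system k >> `<=` measurable.
Proof.
apply: (smallest_sub (@sigma_algebra_measurable _ T)).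
move=> _ [A [B [sA mB ->]]]; apply: measurableI.
  exact: (sigma_family_measurable sA).
exact: (sigma_family_measurable (noise_cylinder_sigma_family _ mB)).
Qed.

(** Pi-lambda argument: the events independent of [E] form a Dynkin system, and it contains the past
    pi-system because the index [(k, l)] is not a past one. *)
Lemma past_independent k l A B : <<s past_pi_system k >> A -> measurable B ->
  P (A `&` eta k l @^-1` B) = (P A * P (eta k l @^-1` B))%E.
Proof.
move=> sA mB; set E := eta k l @^-1` B.
have mE : measurable E by rewrite -[E]setTI; exact: measurable_funPT.
pose H := [set A | measurable A /\ P (A `&` E) = (P A * P E)%E].
suff : H A by case.
move: sA; apply: lambda_system_subset; first exact: past_pi_systemI.
- apply/dynkin_lambda_system; split.
  + by split => //; rewrite setTI probability_setT mul1e.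
  + move=> C [mC CE]; split; first exact: measurableC.
    rewrite setIC -setDE measureD//; last by rewrite ltey_eq fin_num_measure.
    rewrite [X in (_ - X)%E](_ : _ = (P C * P E)%E); last first.
      by rewrite setIC; exact: CE.
    suff : (P E - P C * P E = (1 - P C) * P E)%E by rewrite probability_setC.
    rewrite -(fineK (fin_num_measure P _ mC)) -(fineK (fin_num_measure P _ mE)).
    by rewrite -EFinM -!EFinB -EFinM mulrBl mul1r.
  + move=> F tF HF; split; first by apply: bigcup_measurable => i _; case: (HF i).
    rewrite setI_bigcupl measure_bigcup//; last 2 first.
    * by move=> i _; apply: measurableI => //; case: (HF i).
    * exact: trivIset_setIr.
    rewrite measure_bigcup//; last by move=> i _; case: (HF i).
    rewrite muleC -(fineK (fin_num_measure P _ mE)) -nneseriesZl//.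
    by apply: eq_eseriesr => i _; rewrite fineK ?fin_num_measure// muleC; case: (HF i).
- move=> _ [A0 [B0 [sA0 mB0 ->]]]; split.
    by apply: (@past_pi_system_measurable k); apply: sub_sigma_algebra; exists A0, B0.
  set s := past_indices k; set C := noise_cylinder s B0.
  (* With the constraint at [(k, l)] added, the event [C] intersected with [E] is again a noise
     cylinder. The initial points split off first, then both noise cylinders factor by mutual
     independence. *)
  pose B1 i := if i == (k, l) then B else B0 i.
  have mB1 i : measurable (B1 i) by rewrite /B1; case: ifP.
  have kls : (k, l) \notin s by rewrite mem_past_indices ltnn.
  have B10 i : i \in s -> B1 i = B0 i.
    by move=> si; rewrite /B1; case: eqP => // ikl; rewrite -ikl si in kls.
  have CE : C `&` E = noise_cylinder ((k, l) :: s) B1.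
    apply/seteqP; split => [w [Cw Ew] i /=|w Cw].
      rewrite inE => /predU1P[->|si]; first by rewrite /B1 eqxx.
      by rewrite B10//; exact: Cw.
    split => [i /= si|].
      by rewrite -B10//; apply: Cw; rewrite /= inE si orbT.
    have := Cw (k, l); rewrite /= /B1 eqxx; apply.
    by rewrite inE eqxx.
  have sC : sigma_family (fun kl : nat * 'I_d => eta kl.1 kl.2) C.
    exact: (noise_cylinder_sigma_family _ mB0).
  have sCE : sigma_family (fun kl : nat * 'I_d => eta kl.1 kl.2) (C `&` E).
    by rewrite CE; exact: (noise_cylinder_sigma_family _ mB1).
  rewrite -setIA (x0_eta_indep sA0 sCE).
  rewrite (x0_eta_indep sA0 sC) CE.
  rewrite (eta_indep (s := (k, l) :: s) (B := B1))//=; last first.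
    by rewrite kls uniq_past_indices.
  rewrite big_cons /= {1}/B1 eqxx.
  rewrite /C /noise_cylinder (eta_indep (s := s) (B := B0))//; last first.
    exact: uniq_past_indices.
  rewrite (eq_big_seq (fun i => P (eta i.1 i.2 @^-1` B0 i))); last first.
    by move=> i /B10 ->.
  by rewrite -[RHS]muleA; congr (_ * _)%E; exact: muleC.
- by [].
Qed.

(** Applied below with [h] the identity and with [h x = x ^+ 2 - delta ^+ 2], the two ways in which
    the noise enters the squared distance. *)
Lemma past_independent_fun k l (U : T -> R) (h : R -> R) :
  measurable_fun [set: g_sigma_algebraType (past_pi_system k)] U ->
  measurable_fun [set: R] h ->
  P.-integrable setT (EFin \o U) -> P.-integrable setT (EFin \o (h \o eta k l)) ->
  P.-integrable setT (fun w => (U w * h (eta k l w))%:E) /\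
  (\int[P]_w (U w * h (eta k l w))%:E =
   \int[P]_w (U w)%:E * \int[P]_w (h (eta k l w))%:E)%E.
Proof.
move=> mU mh iU iV.
apply: (@independent_integralM _ _ _ P U (h \o eta k l)) => //.
- move=> _ B mB; apply: past_pi_system_measurable; exact: mU.
- exact: measurableT_comp.
- move=> A B mA mB; apply: (@past_independent k l _ (h @^-1` B)).
    by have := mU measurableT A mA; rewrite setTI.
  by rewrite -[X in measurable X]setTI; exact: mh.
Qed.
End past_independence.

(** * The Euclidean norm and rational approximation *)

Section enorm.
Context {R : realType} {d : nat}.
Implicit Types x y : 'rV[R]_d.

Lemma enorm_ge0 x : 0 <= enorm x.
Proof. exact: sqrtr_ge0. Qed.

Lemma enorm_sqr x : enorm x ^+ 2 = \sum_(l < d) x 0 l ^+ 2.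
Proof. by rewrite sqr_sqrtr// sumr_ge0// => l _; exact: sqr_ge0. Qed.

Lemma enorm_le_sup x (e : R) : 0 <= e -> (forall l, `|x 0 l| <= e) ->
  enorm x <= Num.sqrt d%:R * e.
Proof.
move=> e0 xe; rewrite -[e]ger0_norm// -sqrtr_sqr -sqrtrM ?ler0n// ler_wsqrtr//.
rewrite mulr_natl -[in leRHS](card_ord d) -sumr_const.
by apply: ler_sum => l _; rewrite -real_normK ?num_real// ler_pXn2r ?nnegrE.
Qed.

Lemma rational_row_approx x (e : R) : 0 < e ->
  exists q : 'rV[rat]_d, enorm (x - map_mx ratr q) < e.
Proof.
move=> e0; set s := Num.sqrt d%:R : R; have s0 : 0 <= s by exact: sqrtr_ge0.
(* Adding 1 keeps the denominator positive even if [s = 0] and makes [s * e' < e] strict. *)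
pose e' := e / (s + 1); have e'0 : 0 < e' by rewrite divr_gt0// ltr_wpDl.
have H l : exists q : rat, `|x 0 l - ratr q| <= e'.
  have [q /andP[]] : exists q : rat, x 0 l < ratr q < x 0 l + e'.
    have /rat_in_itvoo[q] : x 0 l < x 0 l + e' by rewrite ltrDl.
    by rewrite in_itv/=; exists q.
  by move=> h1 h2; exists q; rewrite ler_distl; apply/andP; split; lra.
have [q qP] := choice H.
exists (\row_l q l); apply: (@le_lt_trans _ _ (s * e')).
  by apply: enorm_le_sup => [|l]; [exact: ltW|rewrite !mxE].
have s1 : 0 < s + 1 by rewrite ltr_wpDl.
by rewrite /e' mulrA ltr_pdivrMr// mulrDr mulr1 mulrC ltrDl.
Qed.
End enorm.

Lemma escboS (R : realType) (d N : nat) (f : 'rV[R]_d -> R)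
    (beta lambda sigma : R) (alpha : nat -> R) (x0 : 'I_N -> 'rV[R]_d)
    (eta : nat -> 'rV[R]_d) k i l :
  let X := escbo f beta lambda sigma alpha x0 eta k in
  let b := X i 0 l - consensus f beta X 0 l in
  escbo f beta lambda sigma alpha x0 eta k.+1 i 0 l =
  X i 0 l - lambda * b - b * eta k 0 l - alpha k * fd_grad f sigma (X i) 0 l.
Proof.
rewrite /=; move: (consensus _ _ _) (fd_grad _ _ _) => c g.
by rewrite !mxE.
Qed.

(** * Measurability of the consensus point and of the iterates *)

Section measurability_of_iterates.
Context {disp : measure_display} {S : measurableType disp} {R : realType} {d : nat}.

Lemma measurable_enorm (X : S -> 'rV[R]_d) :
  (forall l, measurable_fun setT (fun w => X w 0 l)) ->
  measurable_fun setT (fun w => enorm (X w)).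
Proof.
move=> mX; apply: (@measurableT_comp _ _ _ _ _ _ (@Num.sqrt R)).
  apply: continuous_measurable_fun; exact: sqrt_continuous.
by apply: measurable_sum => l; exact: measurable_funX.
Qed.

(** A Lipschitz [f] is the infimum over rational rows [q] of [f q + L * enorm (x - q)], so each
    strict sublevel set is a countable union of sets that are measurable as soon as the coordinates
    of [X] are. *)
Lemma measurable_lipschitz_comp (f : 'rV[R]_d -> R) (L : R) (X : S -> 'rV[R]_d) :
  0 < L -> (forall x y, `|f x - f y| <= L * enorm (x - y)) ->
  (forall l, measurable_fun setT (fun w => X w 0 l)) ->
  measurable_fun setT (fun w => f (X w)).
Proof.
move=> L0 f_lip mX.
apply: (measurability _ (RGenInftyO.measurableE R)) => //.
move=> _ [_ [c ->] <-]; rewrite setTI.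
rewrite (_ : _ @^-1` _ = \bigcup_(q : 'rV[rat]_d)
    [set w | f (map_mx ratr q) + L * enorm (X w - map_mx ratr q) < c]).
  apply: countable_bigcupT_measurable => // q.
  rewrite (_ : [set w | _] = (fun w => f (map_mx ratr q) +
    L * enorm (X w - map_mx ratr q)) @^-1` `]-oo, c[); last first.
    by apply/seteqP; split => w /=; rewrite in_itv.
  rewrite -[X in measurable X]setTI.
  suff : measurable_fun setT (fun w => f (map_mx ratr q) +
    L * enorm (X w - map_mx ratr q)) by apply.
  apply: measurable_funD => //; apply: measurable_funM => //.
  apply: measurable_enorm => l; under eq_fun do rewrite mxE.
  exact: measurable_funD.
apply/seteqP; split => w /=; rewrite in_itv/=.
  move=> fc.
  (* The term [L * enorm (X w - q)] is paid twice, once to pass from [f (X w)] to [f q] and once in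
     the sum; hence half of the slack for each. *)
  have e0 : 0 < (c - f (X w)) / (2 * L) by rewrite divr_gt0 ?subr_gt0 ?mulr_gt0.
  have [q qP] := rational_row_approx (X w) e0.
  exists q => //=.
  have := f_lip (X w) (map_mx ratr q).
  rewrite ler_distl => /andP[h _].
  have : L * enorm (X w - map_mx ratr q) < (c - f (X w)) / 2.
    move: qP; rewrite invfM mulrA ltr_pdivlMr// mulrC.
    by [].
  lra.
move=> [q _ /=]; have := f_lip (X w) (map_mx ratr q).
rewrite ler_distl => /andP[_ h1 h2]; lra.
Qed.

Variables (N : nat) (f : 'rV[R]_d -> R) (L : R).
Hypotheses (L_gt0 : 0 < L) (f_lip : forall x y, `|f x - f y| <= L * enorm (x - y)).
Variables (beta lambda sigma : R) (alpha : nat -> R).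

Lemma measurable_consensus (X : S -> 'I_N -> 'rV[R]_d) :
  (0 < N)%N -> (forall i l, measurable_fun setT (fun w => X w i 0 l)) ->
  forall l, measurable_fun setT (fun w => consensus f beta (X w) 0 l).
Proof.
move=> N0 mX l.
have mexp i : measurable_fun setT (fun w => expR (- beta * f (X w i))).
  apply: measurableT_comp => //; apply: measurable_funM => //.
  exact: (measurable_lipschitz_comp L_gt0 f_lip).
rewrite /consensus; under eq_fun do rewrite mxE summxE.
apply: measurable_funM.
  (* The inverse of the positive normalizing sum is written as [expR (- ln _)], a composition of
     measurable functions. *)
  rewrite (_ : (fun w => _) =
      (fun w => expR (- ln (\sum_i expR (- beta * f (X w i)))))); last first.
    apply/funext => w; rewrite expRN lnK// posrE (bigD1 (Ordinal N0))//=.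
    by rewrite ltr_pwDl ?expR_gt0// sumr_ge0// => i _; exact: expR_ge0.
  apply: measurableT_comp => //; apply: measurableT_comp => //.
  by apply: measurableT_comp => //; exact: measurable_sum.
apply: measurable_sum => i; under eq_fun do rewrite mxE.
exact: measurable_funM.
Qed.

(** The condition on [eta] concerns indices below [k], so [S] may be the sample space with its full
    sigma-algebra or with that of the past. *)
Lemma measurable_escbo (x0 : S -> 'I_N -> 'rV[R]_d) (eta : S -> nat -> 'rV[R]_d) k :
  (forall i l, measurable_fun setT (fun w => x0 w i 0 l)) ->
  (forall j l, (j < k)%N -> measurable_fun setT (fun w => eta w j 0 l)) ->
  forall i l, measurable_fun setT
    (fun w => escbo f beta lambda sigma alpha (x0 w) (eta w) k i 0 l).
Proof.
move=> mx0; elim: k => [|k IH] meta i l //=.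
have mX := IH (fun j l jk => meta j l (ltnW jk)).
have mc := measurable_consensus (leq_ltn_trans (leq0n i) (ltn_ord i)) mX.
have mf e : measurable_fun setT (fun w =>
    f (escbo f beta lambda sigma alpha (x0 w) (eta w) k i + e)).
  apply: (measurable_lipschitz_comp L_gt0 f_lip) => l'.
  by under eq_fun do rewrite mxE; exact: measurable_funD.
under eq_fun do rewrite escboS.
apply: measurable_funB.
  apply: measurable_funB.
    apply: measurable_funB => //; apply: measurable_funM => //.
    exact: measurable_funB.
  apply: measurable_funM; last exact: meta.
  exact: measurable_funB.
under eq_fun do rewrite mxE.
apply: measurable_funM => //; apply: measurable_funM => //.
apply: measurable_funB => //.
by have := mf 0; under eq_fun do rewrite addr0.
Qed.
End measurability_of_iterates.

(** * Pointwise descent inequalities for one coordinate *)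

Section descent_algebra.
Context {R : realType}.
Implicit Types a c p kap lam delta : R.

(** After expansion, with [s = lam ^+ 2 + delta ^+ 2], the cross terms are [2 * (lam - s) * a * c],
    [- 2 * (1 - lam) * a * p] and [- 2 * lam * c * p]. Young's inequality with weight [kap] handles
    the first two, with weight 1 the third; the hypotheses make the factors [lam - s], [1 - lam] and
    [lam] nonnegative. *)
Lemma descent_coordinate a c p kap lam delta : 0 < kap ->
  lam ^+ 2 + delta ^+ 2 <= lam -> lam <= 1 -> 0 <= lam ->
  (a - lam * (a - c) - p) ^+ 2 + delta ^+ 2 * (a - c) ^+ 2 <=
  (1 - 2 * lam + (lam ^+ 2 + delta ^+ 2)
   + (1 - (lam ^+ 2 + delta ^+ 2)) * kap) * a ^+ 2
  + ((lam - (lam ^+ 2 + delta ^+ 2)) / kap + lam + (lam ^+ 2 + delta ^+ 2))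
    * c ^+ 2
  + ((1 - lam) / kap + lam + 1) * p ^+ 2.
Proof.
move=> kap0 sl l1 l0; set s := lam ^+ 2 + delta ^+ 2.
have young (x y : R) : 2 * x * y <= kap * x ^+ 2 + kap^-1 * y ^+ 2.
  have : 0 <= kap^-1 * (kap * x - y) ^+ 2 by rewrite mulr_ge0 ?sqr_ge0 ?invr_ge0 ?ltW.
  have -> : kap^-1 * (kap * x - y) ^+ 2 =
    kap * x ^+ 2 + kap^-1 * y ^+ 2 - 2 * x * y by field; rewrite lt0r_neq0.
  by rewrite subr_ge0.
have h1 := ler_wpM2l (etrans (subr_ge0 _ _) sl) (young a c).
have h2 := ler_wpM2l (etrans (subr_ge0 _ _) l1) (young (- a) p).
have h3 : lam * (- 2 * c * p) <= lam * (c ^+ 2 + p ^+ 2).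
  by rewrite ler_wpM2l//; have := sqr_ge0 (c + p); nra.
move: h1 h2 h3; rewrite sqrrN /s; lra.
Qed.

(** Adding and subtracting [delta ^+ 2 * b ^+ 2] reduces to the noiseless inequality and isolates,
    on the last line, all the terms that involve the noise [h]. *)
Lemma descent_noisy (X C x p h kap lam delta : R) (a := X - x) (c := C - x)
    (b := a - c) (u := a - lam * b - p) : 0 < kap ->
  lam ^+ 2 + delta ^+ 2 <= lam -> lam <= 1 -> 0 <= lam ->
  (X - lam * (X - C) - (X - C) * h - p - x) ^+ 2 <=
  (1 - 2 * lam + (lam ^+ 2 + delta ^+ 2)
   + (1 - (lam ^+ 2 + delta ^+ 2)) * kap) * a ^+ 2
  + ((lam - (lam ^+ 2 + delta ^+ 2)) / kap + lam + (lam ^+ 2 + delta ^+ 2))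
    * c ^+ 2
  + ((1 - lam) / kap + lam + 1) * p ^+ 2
  + (- 2 * (u * b) * h + b ^+ 2 * (h ^+ 2 - delta ^+ 2)).
Proof.
move=> kap0 sl l1 l0.
have -> : X - lam * (X - C) - (X - C) * h - p - x = u - b * h.
  by rewrite /u /b /a /c; ring.
have -> : (u - b * h) ^+ 2 = u ^+ 2 + delta ^+ 2 * b ^+ 2
    + (- 2 * (u * b) * h + b ^+ 2 * (h ^+ 2 - delta ^+ 2)) by ring.
by rewrite lerD2r; exact: descent_coordinate.
Qed.

End descent_algebra.

(** * Distance from the consensus point to the minimizer *)

Section consensus_bounds.
Context {R : realType} {d N : nat}.
Variables (f : 'rV[R]_d -> R) (beta : R) (xs : 'rV[R]_d).
Hypothesis N_gt0 : (0 < N)%N.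
Implicit Types X : 'I_N -> 'rV[R]_d.

Let weight X i := expR (- beta * f (X i)) / \sum_j expR (- beta * f (X j)).

Let weight_sum_gt0 X : 0 < \sum_j expR (- beta * f (X j)).
Proof.
by rewrite (bigD1 (Ordinal N_gt0))//= ltr_pwDl ?expR_gt0// sumr_ge0//.
Qed.

Let weight_ge0 X i : 0 <= weight X i.
Proof. by rewrite divr_ge0 ?expR_ge0// ltW. Qed.

Let sum_weight X : \sum_i weight X i = 1.
Proof. by rewrite -mulr_suml divff// lt0r_neq0. Qed.

Let weight_le1 X i : weight X i <= 1.
Proof. by rewrite -(sum_weight X) (bigD1 i)//= lerDl sumr_ge0. Qed.

Lemma sum_enorm_sqr_mean X :
  \sum_i enorm (X i - xs) ^+ 2 = N%:R * mean_sqdist xs X.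
Proof. by rewrite /mean_sqdist mulrA divff ?mul1r// pnatr_eq0 -lt0n. Qed.

Lemma mean_sqdist_ge0 X : 0 <= mean_sqdist xs X.
Proof. by rewrite mulr_ge0 ?invr_ge0// sumr_ge0// => i _; exact: sqr_ge0. Qed.

(** In each coordinate, this is nonnegativity of the weighted variance about the weighted mean
    [m]. *)
Let jensen X :
  enorm (consensus f beta X - xs) ^+ 2 <=
  \sum_i weight X i * enorm (X i - xs) ^+ 2.
Proof.
under eq_bigr do rewrite enorm_sqr mulr_sumr.
rewrite enorm_sqr exchange_big/=; apply: ler_sum => l _.
set m := (consensus f beta X - xs) 0 l.
have mE : m = \sum_i weight X i * (X i - xs) 0 l.
  transitivity (\sum_i weight X i * X i 0 l - xs 0 l).
    rewrite /m /consensus !mxE summxE mulr_sumr; congr (_ - _).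
    by apply: eq_bigr => i _; rewrite mxE mulrA [_^-1 * _]mulrC.
  rewrite -[X in _ - X]mul1r -(sum_weight X) mulr_suml -sumrB.
  by apply: eq_bigr => i _; rewrite !mxE mulrBr.
have : 0 <= \sum_i weight X i * ((X i - xs) 0 l - m) ^+ 2.
  by apply: sumr_ge0 => i _; rewrite mulr_ge0 ?sqr_ge0.
have -> : \sum_i weight X i * ((X i - xs) 0 l - m) ^+ 2 =
    \sum_i weight X i * (X i - xs) 0 l ^+ 2 - m ^+ 2; last by rewrite subr_ge0.
transitivity (\sum_i weight X i * (X i - xs) 0 l ^+ 2
    - 2 * m * (\sum_i weight X i * (X i - xs) 0 l)
    + m ^+ 2 * (\sum_i weight X i)).
  rewrite !mulr_sumr -sumrB -big_split/=.
  by apply: eq_bigr => i _; ring.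
by rewrite -mE sum_weight; ring.
Qed.

(** Follows from weights at most 1. The bound is crude but holds for every configuration, and is
    what makes the consensus error integrable. *)
Lemma consensus_sqdist_le X :
  enorm (consensus f beta X - xs) ^+ 2 <= N%:R * mean_sqdist xs X.
Proof.
apply: le_trans (jensen X) _; rewrite -sum_enorm_sqr_mean.
by apply: ler_sum => i _; rewrite ler_piMl ?sqr_ge0.
Qed.

(* Quantitative Laplace principle: particles above the level [v + q] have
   weight at most [expR (- beta * q)]. *)
Lemma consensus_laplace X (v q M : R) (i0 : 'I_N) : 0 <= beta ->
  f (X i0) <= v -> 0 <= M ->
  (forall x, f x <= v + q -> enorm (x - xs) ^+ 2 <= M) ->
  enorm (consensus f beta X - xs) ^+ 2 <=
  M + expR (- beta * q) * (N%:R * mean_sqdist xs X).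
Proof.
move=> b0 fv M0 fM; apply: le_trans (jensen X) _.
have -> : M = \sum_i weight X i * M by rewrite -mulr_suml sum_weight mul1r.
rewrite -sum_enorm_sqr_mean mulr_sumr -big_split/=.
apply: ler_sum => i _; have [fi|fi] := leP (f (X i)) (v + q).
  rewrite -[leLHS]addr0 lerD// ?mulr_ge0 ?expR_ge0 ?sqr_ge0 ?enorm_ge0//.
  by rewrite ler_wpM2l// fM.
rewrite -[leLHS]add0r lerD//; first exact: mulr_ge0 (weight_ge0 X i) M0.
rewrite ler_wpM2r ?sqr_ge0// /weight ler_pdivrMr//.
(* The normalizing sum is bounded below by its single term at [i0], while [f (X i)] exceeds
   [f (X i0)] by more than [q]. *)
apply: (@le_trans _ _ (expR (- beta * q) * expR (- beta * f (X i0)))).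
  rewrite -expRD ler_expR -mulrDr; nra.
by rewrite ler_wpM2l ?expR_ge0// (bigD1 i0)//= lerDl sumr_ge0.
Qed.

End consensus_bounds.

(** * Maximum of the objective on Euclidean balls *)

Section ball_maximum.
Context {R : realType} {d : nat}.
Variables (f : 'rV[R]_d -> R) (L : R) (xs : 'rV[R]_d).
Hypothesis L_ge0 : 0 <= L.
Hypothesis f_lip : forall x y, `|f x - f y| <= L * enorm (x - y).

Lemma abs_coord_le_enorm (x : 'rV[R]_d) l : `|x 0 l| <= enorm x.
Proof.
rewrite -(ler_pXn2r (n := 2))// ?nnegrE ?enorm_ge0// real_normK ?num_real//.
by rewrite enorm_sqr (bigD1 l)//= lerDl sumr_ge0// => i _; exact: sqr_ge0.
Qed.

(** The topology on rows comes from the sup norm; the factor [Num.sqrt d%:R] compares it with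
    [enorm]. *)
Lemma lipschitz_enorm_continuous : continuous f.
Proof.
move=> x; apply: (@cvgrPdist_le _ _ _ (nbhs x) _ f (f x)).2 => e e0.
pose s : R := L * Num.sqrt d%:R + 1.
have sL0 : 0 <= L * Num.sqrt d%:R by rewrite mulr_ge0 ?sqrtr_ge0.
have s0 : 0 < s by rewrite ltr_wpDl.
have es0 : 0 < e / s by rewrite divr_gt0.
apply/nbhs_ballP; exists (e / s) => //= y xy.
apply: le_trans (f_lip x y) _.
apply: (@le_trans _ _ (L * (Num.sqrt d%:R * (e / s)))).
  rewrite ler_wpM2l//; apply: enorm_le_sup => [|l]; first exact: ltW.
  by rewrite !mxE; apply: ltW; have [_ xyl] := xy; exact: xyl.
by rewrite !mulrA ler_pdivrMr// [leRHS]mulrC ler_wpM2r ?(ltW e0)// /s lerDl.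
Qed.

(** The ball is a closed subset of a compact box; closedness is read off from the continuous
    polynomial [enorm (v - xs) ^+ 2]. *)
Lemma compact_cball r : 0 <= r -> compact (cball xs r).
Proof.
move=> r0.
have box : compact [set v : 'rV[R]_d | forall i, v ord0 i \in
    `[xs ord0 i - r, xs ord0 i + r]].
  apply: (@rV_compact _ _ (fun i => `[xs ord0 i - r, xs ord0 i + r]%classic)).
  by move=> i; exact: segment_compact.
apply: subclosed_compact box _; last first.
  move=> v vr i /=; rewrite in_itv/= -ler_distl.
  apply: le_trans vr; have := abs_coord_le_enorm (v - xs) i.
  by rewrite !mxE.
rewrite (_ : cball xs r = (fun v : 'rV[R]_d =>
    \sum_(l < d) (v ord0 l - xs ord0 l) ^+ 2) @^-1` [set y | y <= r ^+ 2]).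
  apply: closed_comp; last exact: closed_le.
  move=> v _; move: v; apply: continuous_big.
    exact: (@pseudometric_normed_Zmodule.add_continuous R R^o).
  move=> l _ v; apply: (@continuous_comp _ _ _
    (fun v : 'rV[R]_d => v ord0 l - xs ord0 l) (fun t : R => t ^+ 2)).
    apply: (@cvgB _ R^o); [exact: (nbhs_filter v)|exact: (@coord_continuous R _ _ ord0 l v)|].
    exact: (@cvg_cst _ _ _ _ (nbhs_filter v)).
  exact: exprn_continuous.
apply/seteqP; split => v /=; rewrite /cball/=.
  move=> vr; rewrite -[leLHS](_ : enorm (v - xs) ^+ 2 = _).
    by rewrite ler_pXn2r ?nnegrE ?enorm_ge0.
  by rewrite enorm_sqr; apply: eq_bigr => l _; rewrite !mxE.
move=> vr; rewrite -(ler_pXn2r (n := 2))// ?nnegrE ?enorm_ge0//.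
by rewrite enorm_sqr; under eq_bigr do rewrite !mxE.
Qed.

(** By compactness the maximum is attained, so the default value of [set_max] does not occur. *)
Lemma le_ball_max r x : cball xs r x -> f x <= ball_max f xs r.
Proof.
move=> xr; have r0 : 0 <= r by exact: le_trans (enorm_ge0 _) xr.
have [c cr cmax] := @compact_EVT_max _ _ f (cball xs r) (ex_intro _ x xr)
  (compact_cball r0) (continuous_subspaceT lipschitz_enorm_continuous).
rewrite /ball_max /set_max; case: xgetP => [y _ [_ yub]|].
  by apply: yub; exists x.
move=> /(_ (f c)); case; split; first by exists c => //; rewrite -inE.
by move=> _ [z zr <-]; apply: cmax; rewrite inE.
Qed.

(* If no radius qualifies then [r_radius] is the junk value 0, and the ball is
   reduced to [xs]. *)
Lemma particle_below_level N (X : 'I_N -> 'rV[R]_d) (R0 q : R) : 0 <= q ->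
  particles_in_ball xs (r_radius f xs R0 q) X !=set0 ->
  exists i, f (X i) <= f xs + q.
Proof.
move=> q0 [i]; rewrite /particles_in_ball/= => Xi; exists i.
move: Xi; rewrite /r_radius {1}/set_max; case: xgetP => [r _ [[_ rq] _]|_].
  by move=> /le_ball_max; lra.
rewrite /cball/= => X0.
have /eqP xi0 : enorm (X i - xs) == 0 by rewrite eq_le X0 enorm_ge0.
by have := f_lip (X i) xs; rewrite xi0 mulr0 normr_le0 subr_eq0 => /eqP ->; rewrite lerDl.
Qed.
End ball_maximum.

(** * The choice of [kappa] and the contraction factor *)

Section kappa.
Context {R : realType}.
Variables xi lambda delta : R.
Hypotheses (xi_gt0 : 0 < xi) (xi_lt1 : xi < 1) (lambda_gt0 : 0 < lambda).
Hypothesis gap_gt0 : 0 < gap lambda delta.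
Local Notation kap := (kappa xi lambda delta).
Local Notation s := (lambda ^+ 2 + delta ^+ 2).

Let s_gt0 : 0 < s.
Proof. by rewrite ltr_wpDr ?sqr_ge0// exprn_gt0. Qed.

Let s_lt_lambda : s < lambda.
Proof. by move: gap_gt0; rewrite /gap; lra. Qed.

Lemma lambda_lt1 : lambda < 1.
Proof. by have := sqr_ge0 delta; have := s_lt_lambda; nra. Qed.

Lemma kappa_gt0 : 0 < kap.
Proof.
have xg : 0 < xi * gap lambda delta by exact: mulr_gt0.
have sq := sqrtr_ge0 s; have ss := s_gt0.
rewrite /kappa lt_min; apply/andP; split.
  by rewrite divr_gt0//; lra.
by rewrite sqrtr_gt0 divr_gt0//; lra.
Qed.

(** The left side equals [1 - 2 * lambda + s + 2 * (1 - s) * kap + (2 * lambda + s + 1) * kap ^+ 2].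
    The first argument of the minimum defining [kappa] bounds the linear term by [xi * gap / 2], and
    the second does so for the quadratic term, using [2 * lambda <= lambda ^+ 2 + 1]. The total is
    at most [rate - s], and [s > 0] gives strictness. *)
Lemma kappa_contraction :
  1 - 2 * lambda + s + (1 - s) * kap
  + ((lambda - s) / kap + lambda + s) * kap ^+ 2
  + ((1 - lambda) / kap + lambda + 1) * kap ^+ 2 < rate xi lambda delta.
Proof.
have k0 := kappa_gt0; have sq := sqrtr_ge0 s; have ss := s_gt0.
have sl := s_lt_lambda; have l1 := lambda_lt1.
have xg : 0 < xi * gap lambda delta by exact: mulr_gt0.
have h1 : kap * (4 * (2 * lambda ^+ 2 + 2 * delta ^+ 2 + Num.sqrt s + 1))
    <= xi * gap lambda delta.
  rewrite -ler_pdivlMr; last lra.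
  by rewrite /kappa ge_min lexx.
have h2 : kap ^+ 2 * (2 * (2 * lambda ^+ 2 + 2 * delta ^+ 2 + 2))
    <= xi * gap lambda delta.
  rewrite -ler_pdivlMr; last lra.
  set t := _ / _; have t0 : 0 <= t by rewrite divr_ge0 ?ltW//; lra.
  rewrite -(sqr_sqrtr t0) ler_pXn2r ?nnegrE ?sqrtr_ge0 ?(ltW k0)//.
  by rewrite /kappa ge_min lexx orbT.
have -> : ((lambda - s) / kap + lambda + s) * kap ^+ 2 =
    (lambda - s) * kap + (lambda + s) * kap ^+ 2.
  by field; exact: lt0r_neq0.
have -> : ((1 - lambda) / kap + lambda + 1) * kap ^+ 2 =
    (1 - lambda) * kap + (lambda + 1) * kap ^+ 2.
  by field; exact: lt0r_neq0.
have h3 : kap * (1 - s) <= kap * (2 * lambda ^+ 2 + 2 * delta ^+ 2 + Num.sqrt s + 1).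
  by rewrite ler_pM2l//; lra.
have h4 : kap ^+ 2 * (2 * lambda + s + 1) <= kap ^+ 2 * (2 * s + 2).
  rewrite ler_pM2l ?exprn_gt0//; have := sqr_ge0 (lambda - 1); have := sqr_ge0 delta.
  lra.
move: h1 h2 h3 h4; rewrite /rate.
set k := kap in k0 *; set g := gap lambda delta in xg *.
have -> : g = 2 * lambda - 2 * s by rewrite /g /gap; ring.
lra.
Qed.
End kappa.

(** * Integrability by domination, and variables of nonpositive mean *)

Section one_step.
Context {disp : measure_display} {T : measurableType disp} {R : realType}.
Variable P : probability T R.

Lemma integrable_dominated (phi W : T -> R) (C : R) :
  measurable_fun setT phi -> (forall w, `|phi w| <= C * (1 + W w)) ->
  P.-integrable setT (EFin \o W) -> P.-integrable setT (EFin \o phi).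
Proof.
move=> mphi phiC iW.
apply: (@le_integrable _ _ _ P _ _ _ (fun w => C%:E * (1%:E + (W w)%:E))%E) => //.
- exact/measurable_EFinP.
- move=> w _; rewrite -EFinD -EFinM !abse_EFin lee_fin.
  by apply: le_trans (phiC w) _; exact: ler_norm.
- apply: integrableZl => //; apply: integrableD => //.
  exact: finite_measure_integrable_cst.
Qed.

(** Integrability is bundled with the sign so that both pass together through sums and nonnegative
    scalings. *)
Definition nonpos_mean (g : T -> R) :=
  P.-integrable setT (EFin \o g) /\ (\int[P]_w (g w)%:E <= 0)%E.

Lemma nonpos_meanD g h : nonpos_mean g -> nonpos_mean h ->
  nonpos_mean (fun w => g w + h w).
Proof.
move=> [ig g0] [ih h0]; split; first exact: (integrableD measurableT ig ih).
under eq_integral do rewrite EFinD.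
by rewrite integralD//= adde_le0.
Qed.

Lemma nonpos_mean_sum (I : Type) (r : seq I) (g : I -> T -> R) :
  (forall i, nonpos_mean (g i)) -> nonpos_mean (fun w => \sum_(i <- r) g i w).
Proof.
move=> gP; elim: r => [|i r IH].
  under eq_fun do rewrite big_nil.
  by split; [exact: finite_measure_integrable_cst|rewrite integral0].
by under eq_fun do rewrite big_cons; exact: nonpos_meanD.
Qed.

Lemma nonpos_meanZ (c : R) g : 0 <= c -> nonpos_mean g ->
  nonpos_mean (fun w => c * g w).
Proof.
move=> c0 [ig g0]; split.
  by have := integrableZl measurableT c ig.
under eq_integral do rewrite EFinM.
by rewrite integralZl// mule_ge0_le0.
Qed.
End one_step.

(** * One step of the algorithm in expectation *)

Section escbo_step.
Context {disp : measure_display} {T : measurableType disp} {R : realType}.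
Variables (P : probability T R) (d N : nat) (N_gt0 : (0 < N)%N).
Variables (f : 'rV[R]_d -> R) (Lf : R) (Lf_gt0 : 0 < Lf).
Hypothesis f_lip : forall x y, `|f x - f y| <= Lf * enorm (x - y).
Variables (xs : 'rV[R]_d) (beta lambda delta sigma : R) (alpha : nat -> R).
Variable Mg : R.
Hypothesis g_bound : forall x, enorm (fd_grad f sigma x) <= Mg.
Variables (x0 : 'I_N -> 'I_d -> {RV P >-> R}) (eta : nat -> 'I_d -> {RV P >-> R}).
Hypothesis eta_law : forall k l A, measurable A ->
  distribution P (eta k l) A = centered_gauss delta A.
Hypothesis eta_indep :
  mutually_independent (fun kl : nat * 'I_d => eta kl.1 kl.2).
Let x0' (il : 'I_N * 'I_d) := x0 il.1 il.2.
Hypothesis x0_eta_indep : independent_systems P (sigma_family x0')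
  (sigma_family (fun kl : nat * 'I_d => eta kl.1 kl.2)).

Local Notation X k w := (escbo f beta lambda sigma alpha
  (fun i => \row_l x0 i l w) (fun j => \row_l eta j l w) k).
Local Notation W k := (fun w => mean_sqdist xs (X k w)).
Local Notation E k := (fun w => enorm (consensus f beta (X k w) - xs) ^+ 2).

Lemma measurable_iterate k i l : measurable_fun setT (fun w => X k w i 0 l).
Proof.
apply: (measurable_escbo Lf_gt0 f_lip) => [i' l'|j l' _].
  by under eq_fun do rewrite mxE; exact: measurable_funPT.
by under eq_fun do rewrite mxE; exact: measurable_funPT.
Qed.

Lemma measurable_mean_sqdist k : measurable_fun setT (W k).
Proof.
apply: measurable_funM => //; apply: measurable_sum => i.
apply: measurable_funX; apply: measurable_enorm => l.
under eq_fun do rewrite !mxE.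
by apply: measurable_funB => //; exact: measurable_iterate.
Qed.

Lemma measurable_consensus_sqdist k : measurable_fun setT (E k).
Proof.
apply: measurable_funX; apply: measurable_enorm => l.
under eq_fun do rewrite [(_ - xs) _ _]mxE [(- xs) _ _]mxE.
apply: measurable_funB => //.
exact: (measurable_consensus Lf_gt0 f_lip beta N_gt0 (measurable_iterate k)).
Qed.

Lemma integrable_consensus_sqdist k : P.-integrable setT (EFin \o W k) ->
  P.-integrable setT (EFin \o E k).
Proof.
apply: (@integrable_dominated _ _ _ P _ _ N%:R); first exact: measurable_consensus_sqdist.
move=> w; rewrite ger0_norm ?sqr_ge0//.
apply: le_trans (consensus_sqdist_le f beta xs N_gt0 (X k w)) _.
by rewrite ler_wpM2l// lerDr.
Qed.

(** Integrates [consensus_laplace] at level [v = f xs + q]; the low particle [i] may depend on the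
    realization [w]. *)
Lemma mean_consensus_laplace k (q M : R) : 0 <= beta -> 0 <= M ->
  (forall x, f x <= f xs + q + q -> enorm (x - xs) ^+ 2 <= M) ->
  (\forall w \ae P, exists i, f (X k w i) <= f xs + q) ->
  P.-integrable setT (EFin \o W k) ->
  (\int[P]_w (E k w)%:E <=
   M%:E + (expR (- beta * q) * N%:R)%:E * \int[P]_w (W k w)%:E)%E.
Proof.
move=> beta_ge0 M_ge0 fM low iW.
have iM := finite_measure_integrable_cst P M measurableT.
have iZ := integrableZl measurableT (expR (- beta * q) * N%:R) iW.
apply: (@le_trans _ _ (\int[P]_w (M%:E
    + (expR (- beta * q) * N%:R)%:E * (W k w)%:E))%E); last first.
  by rewrite integralD// integralZl// integral_cst//= probability_setT mule1.
apply: ae_ge0_le_integral => //.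
- by move=> w _; rewrite lee_fin sqr_ge0.
- by apply/measurable_EFinP; exact: measurable_consensus_sqdist.
- move=> w _; rewrite -EFinM -EFinD lee_fin; apply: addr_ge0 => //.
  by apply: mulr_ge0; [rewrite mulr_ge0 ?expR_ge0|exact: mean_sqdist_ge0].
- exact: measurable_int (integrableD measurableT iM iZ).
apply: filterS low => w [i fi] _; rewrite -EFinM -EFinD lee_fin -mulrA.
exact: (consensus_laplace N_gt0 beta_ge0 fi M_ge0 fM).
Qed.

Section increment.
Variable k : nat.
Hypothesis iW : P.-integrable setT (EFin \o W k).

Local Notation past := (g_sigma_algebraType (past_pi_system x0' eta k)).
Let a i l w := X k w i 0 l - xs 0 l.
Let c l w := consensus f beta (X k w) 0 l - xs 0 l.
Let g i l w : R := fd_grad f sigma (X k w i) 0 l.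
Let b i l w := a i l w - c l w.
(** The next displacement from [xs] before the noise term [b * eta] is subtracted; like [b], it
    depends only on the past. *)
Let u i l w := a i l w - lambda * b i l w - alpha k * g i l w.

Let pX i l : measurable_fun [set: past] (fun w => X k w i 0 l).
Proof.
apply: (measurable_escbo (S := past) Lf_gt0 f_lip) => [i' l'|j l' jk].
  under eq_fun do rewrite mxE.
  exact: (@past_measurable_x0 _ _ _ _ _ _ x0' eta k (i', l')).
by under eq_fun do rewrite mxE; exact: past_measurable_eta.
Qed.

Let pa i l : measurable_fun [set: past] (a i l).
Proof. exact: measurable_funB. Qed.

Let pc l : measurable_fun [set: past] (c l).
Proof.
apply: measurable_funB => //.
exact: (measurable_consensus (S := past) Lf_gt0 f_lip beta N_gt0 pX).
Qed.

Let pg i l : measurable_fun [set: past] (g i l).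
Proof.
have pf e : measurable_fun [set: past] (fun w => f (X k w i + e)).
  apply: (measurable_lipschitz_comp (S := past) Lf_gt0 f_lip) => l'.
  by under eq_fun do rewrite mxE; exact: measurable_funD.
rewrite /g /fd_grad; under eq_fun do rewrite mxE.
apply: measurable_funM => //; apply: measurable_funB => //.
by have := pf 0; under eq_fun do rewrite addr0.
Qed.

Let pb i l : measurable_fun [set: past] (b i l).
Proof. exact: measurable_funB. Qed.

Let pu i l : measurable_fun [set: past] (u i l).
Proof.
apply: measurable_funB; last exact: measurable_funM.
by apply: measurable_funB => //; exact: measurable_funM.
Qed.

Let past_T (U : T -> R) : measurable_fun [set: past] U -> measurable_fun [set: T] U.
Proof.
by move=> mU _ B mB; apply: (@past_pi_system_measurable _ _ _ _ _ _ x0' eta k); exact: mU.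
Qed.

Let W_ge0 w : 0 <= W k w.
Proof. exact: mean_sqdist_ge0. Qed.

Let a_le i l w : a i l w ^+ 2 <= N%:R * W k w.
Proof.
rewrite -sum_enorm_sqr_mean// (bigD1 i)//= enorm_sqr (bigD1 l)//= !mxE -addrA lerDl.
by rewrite addr_ge0// sumr_ge0// => j _; exact: sqr_ge0.
Qed.

Let c_le l w : c l w ^+ 2 <= N%:R * W k w.
Proof.
apply: le_trans (consensus_sqdist_le f beta xs N_gt0 (X k w)).
rewrite enorm_sqr (bigD1 l)//= [(_ - xs) _ _]mxE [(- xs) _ _]mxE lerDl.
by rewrite sumr_ge0// => j _; exact: sqr_ge0.
Qed.

Let g_le i l w : g i l w ^+ 2 <= Mg ^+ 2.
Proof.
apply: (@le_trans _ _ (enorm (fd_grad f sigma (X k w i)) ^+ 2)).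
  by rewrite enorm_sqr (bigD1 l)//= lerDl sumr_ge0// => j _; exact: sqr_ge0.
by rewrite ler_pXn2r ?nnegrE ?enorm_ge0// (le_trans (enorm_ge0 _) (g_bound (X k w i))).
Qed.

Let b_le i l w : b i l w ^+ 2 <= 4 * N%:R * W k w.
Proof.
have := a_le i l w; have := c_le l w; have := sqr_ge0 (a i l w + c l w).
rewrite /b; lra.
Qed.

Let bC : R := 4 * N%:R.
Let uC : R := 3 * N%:R + 3 * lambda ^+ 2 * (4 * N%:R) + 3 * (alpha k ^+ 2 * Mg ^+ 2).

(** The three summands of [uC] come from [(A - B - G) ^+ 2 <= 3 * (A ^+ 2 + B ^+ 2 + G ^+ 2)] and
    the bounds on [a], [b] and [g]. Domination by [1 + W] gives integrability of the noise
    coefficients. *)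
Let u_le i l w : u i l w ^+ 2 <= uC * (1 + W k w).
Proof.
have h1 := a_le i l w.
have h2 := ler_wpM2l (sqr_ge0 lambda) (b_le i l w).
have h3 := ler_wpM2l (sqr_ge0 (alpha k)) (g_le i l w).
have h4 := mulr_ge0 (mulr_ge0 (sqr_ge0 (alpha k)) (sqr_ge0 Mg)) (W_ge0 w).
have h5 := mulr_ge0 (sqr_ge0 lambda) (ler0n R N).
have h6 := ler0n R N.
move: (W_ge0 w) (mulr_ge0 (sqr_ge0 lambda) (ler0n R N)).
rewrite /u /uC; set A := a i l w in h1 *; set B := lambda * b i l w.
set G := alpha k * g i l w.
have : (A - B - G) ^+ 2 <= 3 * A ^+ 2 + 3 * B ^+ 2 + 3 * G ^+ 2.
  have := sqr_ge0 (A + B); have := sqr_ge0 (A + G); have := sqr_ge0 (B - G).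
  lra.
rewrite /B /G !exprMn; lra.
Qed.

Let Z i l w : R := - 2 * (u i l w * b i l w) * eta k l w
  + b i l w ^+ 2 * (eta k l w ^+ 2 - delta ^+ 2).

(** Both coefficients are integrable functions of the past, hence independent of [eta k l]: the
    linear part has mean zero, and the quadratic part has nonpositive mean by the second moment
    bound. *)
Let nonpos_Z i l : nonpos_mean P (Z i l).
Proof.
have iE := centered_gauss_integrable (eta_law k l).
have iE2 := centered_gauss_integrable_sqr (eta_law k l).
have mE := centered_gauss_mean (eta_law k l).
have mE2 := centered_gauss_second_moment (eta_law k l).
have pub : measurable_fun [set: past] (fun w => - 2 * (u i l w * b i l w)).
  by apply: measurable_funM => //; exact: measurable_funM.
have pb2 : measurable_fun [set: past] (fun w => b i l w ^+ 2).
  exact: measurable_funX.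
have iub : P.-integrable setT (EFin \o (fun w => - 2 * (u i l w * b i l w))).
  apply: (@integrable_dominated _ _ _ P _ _ (uC + bC)) iW; first exact: past_T.
  move=> w; apply: (@le_trans _ _ (u i l w ^+ 2 + b i l w ^+ 2)).
    rewrite ler_norml; apply/andP; split.
      by have := sqr_ge0 (u i l w - b i l w); lra.
    by have := sqr_ge0 (u i l w + b i l w); lra.
  by have := u_le i l w; have := b_le i l w; have := ler0n R N; rewrite /bC; lra.
have ib2 : P.-integrable setT (EFin \o (fun w => b i l w ^+ 2)).
  apply: (@integrable_dominated _ _ _ P _ _ bC) iW; first exact: past_T.
  move=> w; rewrite ger0_norm ?sqr_ge0//.
  by have := b_le i l w; have := ler0n R N; rewrite /bC; lra.
apply: nonpos_meanD.
  have mid : measurable_fun [set: R] (id : R -> R) by exact: measurable_id.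
  have [i1 E1] := past_independent_fun eta_indep x0_eta_indep (h := id) pub mid iub iE.
  by split => //; rewrite E1 mE mule0.
have ie2 : P.-integrable setT (EFin \o ((fun x : R => x ^+ 2 - delta ^+ 2) \o eta k l)).
  have := integrableB measurableT iE2 (finite_measure_integrable_cst P (delta ^+ 2) measurableT).
  by apply: eq_integrable.
have mh : measurable_fun [set: R] (fun x : R => x ^+ 2 - delta ^+ 2).
  by apply: measurable_funB => //; exact: measurable_funX.
have [i1 E1] := past_independent_fun eta_indep x0_eta_indep pb2 mh ib2 ie2.
split => //; rewrite E1 mule_ge0_le0//.
  by apply: integral_ge0 => w _; rewrite lee_fin sqr_ge0.
under eq_integral do rewrite EFinB.
rewrite integralB//=; last exact: finite_measure_integrable_cst.
rewrite integral_cst//= probability_setT mule1.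
by rewrite leeBlDr// add0e.
Qed.

Variable kap : R.
Hypotheses (kap_gt0 : 0 < kap) (s_le : lambda ^+ 2 + delta ^+ 2 <= lambda)
  (lambda_le1 : lambda <= 1) (lambda_ge0 : 0 <= lambda).
Local Notation s := (lambda ^+ 2 + delta ^+ 2).
Let A : R := 1 - 2 * lambda + s + (1 - s) * kap.
Let B : R := (lambda - s) / kap + lambda + s.
Let D : R := (1 - lambda) / kap + lambda + 1.

Let D_ge0 : 0 <= D.
Proof. by rewrite !addr_ge0// divr_ge0 ?subr_ge0// ltW. Qed.

(** Pathwise sum of [descent_noisy] over coordinates, averaged over particles; the gradient
    coordinates recombine into a norm bounded by [Mg]. *)
Let W_next w : W k.+1 w <=
  A * W k w + B * E k w + D * (alpha k * Mg) ^+ 2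
  + N%:R^-1 * \sum_i \sum_l Z i l w.
Proof.
have N0 : N%:R != 0 :> R by rewrite pnatr_eq0 -lt0n.
have mean_affine (A' B' S e m : R) :
    A' * (N%:R^-1 * S) + B' * e + m = N%:R^-1 * (A' * S + (B' * e) *+ N + m *+ N).
  by rewrite -[(B' * e) *+ N]mulr_natr -[m *+ N]mulr_natr; field.
have -> : A * W k w + B * E k w + D * (alpha k * Mg) ^+ 2 =
    N%:R^-1 * \sum_(i < N) (A * enorm (X k w i - xs) ^+ 2 + B * E k w
      + D * (alpha k * Mg) ^+ 2).
  rewrite big_split/= big_split/= -mulr_sumr !sumr_const card_ord.
  by rewrite -[RHS]mean_affine.
rewrite -mulrDr -big_split/= ler_wpM2l ?invr_ge0//.
apply: ler_sum => i _; rewrite !enorm_sqr.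
apply: (@le_trans _ _ (\sum_l (A * a i l w ^+ 2 + B * c l w ^+ 2
    + D * (alpha k * g i l w) ^+ 2 + Z i l w))).
  apply: ler_sum => l _.
  rewrite [(_ - xs) _ _]mxE [(- xs) _ _]mxE escboS [(\row__ _) _ _]mxE.
  exact: descent_noisy.
rewrite !big_split/= lerD2r -!mulr_sumr.
apply: lerD; first apply: lerD.
- by rewrite (eq_bigr (fun l => (X k w i - xs) 0 l ^+ 2))// => l _; rewrite !mxE.
- rewrite (eq_bigr (fun l => (consensus f beta (X k w) - xs) 0 l ^+ 2))// => l _.
  by rewrite [in RHS]mxE [(- xs) _ _]mxE.
- rewrite ler_wpM2l// exprMn; under eq_bigr do rewrite exprMn.
  rewrite -mulr_sumr ler_wpM2l ?sqr_ge0// -enorm_sqr.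
  by rewrite ler_pXn2r ?nnegrE ?enorm_ge0// (le_trans (enorm_ge0 _) (g_bound (X k w i))).
Qed.

(** Integrates [W_next], where the noise sum has nonpositive mean. Its right side is integrable and
    dominates [W k.+1], so integrability propagates along the iteration. *)
Lemma escbo_step :
  P.-integrable setT (EFin \o W k.+1) /\
  (\int[P]_w (W k.+1 w)%:E <= A%:E * \int[P]_w (W k w)%:E
     + B%:E * \int[P]_w (E k w)%:E + (D * (alpha k * Mg) ^+ 2)%:E)%E.
Proof.
pose S w := N%:R^-1 * \sum_i \sum_l Z i l w.
have [iS S0] : nonpos_mean P S.
  apply: nonpos_meanZ; first by rewrite invr_ge0.
  by apply: nonpos_mean_sum => i; exact: nonpos_mean_sum.
pose V w := A * W k w + B * E k w + D * (alpha k * Mg) ^+ 2.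
have iE := integrable_consensus_sqdist iW.
have iAW : P.-integrable setT (fun w => A%:E * (W k w)%:E)%E.
  exact: integrableZl.
have iBE : P.-integrable setT (fun w => B%:E * (E k w)%:E)%E.
  exact: integrableZl.
have iD := finite_measure_integrable_cst P (D * (alpha k * Mg) ^+ 2) measurableT.
have iAB := integrableD measurableT iAW iBE.
have iV : P.-integrable setT (EFin \o V) by exact: (integrableD measurableT iAB iD).
have iVS := integrableD measurableT iV iS.
have W0 w : 0 <= W k.+1 w by exact: mean_sqdist_ge0.
have iW' : P.-integrable setT (EFin \o W k.+1).
  apply: le_integrable iVS => //; first by apply/measurable_EFinP; exact: measurable_mean_sqdist.
  move=> w _; rewrite -EFinD !abse_EFin lee_fin ger0_norm//.
  exact: le_trans (W_next w) (ler_norm _).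
split => //; apply: (@le_trans _ _ (\int[P]_w ((V w)%:E + (S w)%:E)))%E.
  apply: le_integral => // w _; rewrite -EFinD lee_fin; exact: W_next.
rewrite integralD//; apply: (@le_trans _ _ (\int[P]_w (V w)%:E)%E).
  by rewrite -[leRHS]adde0 leeD2l.
have -> : (\int[P]_w (V w)%:E = \int[P]_w (A%:E * (W k w)%:E
    + B%:E * (E k w)%:E + (D * (alpha k * Mg) ^+ 2)%:E))%E by [].
by rewrite integralD// integralD// !integralZl// integral_cst//= probability_setT mule1.
Qed.

End increment.
End escbo_step.

(** * The levels [q_level] and the growth condition *)

Section levels.
Context {R : realType} {d : nat}.
Variables (f : 'rV[R]_d -> R) (xs : 'rV[R]_d) (finf R0 nu mu : R).
Hypotheses (finf_gt0 : 0 < finf) (nu_gt0 : 0 < nu) (mu_gt0 : 0 < mu).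
Hypothesis xs_min : forall x, f xs <= f x.
Hypothesis f_growth : forall x, cball xs R0 x ->
  mu * enorm (x - xs) <= (f x - f xs) `^ nu.
Hypothesis f_far : forall x, ~ cball xs R0 x -> finf < f x - f xs.

Let sqrt2_gt0 : 0 < Num.sqrt 2 :> R.
Proof. by rewrite sqrtr_gt0. Qed.

Lemma q_level_gt0 C : 0 < C -> 0 < q_level finf mu nu C.
Proof.
by move=> C0; rewrite mulr_gt0 ?invr_gt0// lt_min finf_gt0 powR_gt0// divr_gt0// mulr_gt0.
Qed.

(** Monotonicity turns a lower bound on [E[W]] into one on the level. *)
Lemma le_q_level C C' : 0 <= C -> C <= C' ->
  q_level finf mu nu C <= q_level finf mu nu C'.
Proof.
move=> C0 CC'; rewrite ler_wpM2l ?invr_ge0//.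
rewrite le_min ge_min lexx/= ge_min; apply/orP; right.
have s0 : 0 <= (Num.sqrt 2 : R)^-1 by rewrite invr_ge0 ltW.
have mC : mu * C / Num.sqrt 2 <= mu * C' / Num.sqrt 2.
  by rewrite ler_wpM2r// ler_pM2l.
have mC0 : 0 <= mu * C / Num.sqrt 2 by rewrite mulr_ge0// mulr_ge0// ltW.
apply: ge0_ler_powR => //; rewrite ?nnegrE//; first by rewrite invr_ge0 ltW.
exact: le_trans mC.
Qed.

(** The factor one half in [q_level] is made for this: twice the level is at most [finf], which
    forces [x] into the ball of radius [R0], and at most [t], whose power [nu] bounds the growth
    condition. *)
Lemma sublevel_ball C x : 0 <= C ->
  f x <= f xs + q_level finf mu nu C + q_level finf mu nu C ->
  enorm (x - xs) ^+ 2 <= C ^+ 2 / 2.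
Proof.
move=> C0 fx; set t := (mu * C / Num.sqrt 2) `^ nu^-1.
have {}fx : f x - f xs <= Num.min finf t.
  by move: fx; rewrite /q_level -/t; lra.
move: fx; rewrite le_min => /andP[fx1 fx2].
have xR0 : cball xs R0 x.
  by apply: contrapT => /f_far; rewrite ltNge fx1.
have h0 : 0 <= mu * C / Num.sqrt 2.
  by rewrite divr_ge0 ?(ltW sqrt2_gt0)// mulr_ge0// ltW.
have h : mu * enorm (x - xs) <= mu * C / Num.sqrt 2.
  apply: le_trans (f_growth xR0) _.
  have -> : mu * C / Num.sqrt 2 = t `^ nu.
    by rewrite -powRrM mulVf ?lt0r_neq0// powRr1.
  apply: ge0_ler_powR => //; rewrite ?nnegrE ?subr_ge0 ?powR_ge0//.
  exact: ltW.
move: h; rewrite -mulrA ler_pM2l// => h.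
have -> : C ^+ 2 / 2 = (C / Num.sqrt 2) ^+ 2 by rewrite expr_div_n sqr_sqrtr.
by rewrite ler_pXn2r// ?nnegrE ?enorm_ge0// divr_ge0// ltW.
Qed.
End levels.

(** * The horizon and the iteration count *)

Section horizon.
Context {R : realType}.
Variables (eps : R) (C4 : nat -> R) (EW EX : nat -> \bar R).

Let good k := (eps%:E < EW k)%E /\ (EX k <= (C4 k ^+ 2)%:E)%E.

Lemma horizon_eq k : (forall j, (j < k)%N -> good j) -> ~ good k ->
  horizon eps C4 EW EX = (k%:R : R)%:E.
Proof.
move=> gk ngk; rewrite /horizon; apply/eqP; rewrite eq_le; apply/andP; split.
  rewrite ge_max lee_fin ler0n/=; apply: ge_ereal_sup => _ [n [n0 gn] <-].
  rewrite lee_fin ler_nat leqNgt; apply/negP => kn; exact/ngk/gn.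
(* At [k = 0] no positive integer qualifies, and the lower bound comes from the [maxe 0] in
   [horizon]. *)
case: k gk {ngk} => [|k] gk; first by rewrite le_max lexx.
rewrite le_max; apply/orP; right; apply: ereal_sup_ubound.
by exists k.+1.
Qed.

Lemma lt_horizon k : (forall j, (j <= k)%N -> good j) ->
  ((k%:R : R)%:E < horizon eps C4 EW EX)%E.
Proof.
move=> gk; apply: (@lt_le_trans _ _ ((k.+1%:R : R)%:E)).
  by rewrite lte_fin ltr_nat.
rewrite /horizon le_max; apply/orP; right; apply: ereal_sup_ubound.
by exists k.+1.
Qed.
End horizon.

(** In logarithms the bound reads [ln (w / eps) <= K_eps * ln gamma^-1], which the ceiling
    guarantees. Positivity makes the cast to [nat] faithful and gives access to the strict decay,
    which holds for positive indices. *)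
Lemma K_eps_spec (R : realType) (gamma w eps : R) :
  0 < gamma -> gamma < 1 -> 0 < eps -> eps < w ->
  (0 < K_eps gamma w eps)%N /\ gamma ^+ K_eps gamma w eps * w <= eps.
Proof.
move=> g0 g1 e0 ew; have w0 := lt_trans e0 ew.
have L0 : 0 < ln gamma^-1 by rewrite ln_gt0// invf_gt1.
have l0 : 0 < ln (w / eps) by rewrite ln_gt0// ltr_pdivlMr// mul1r.
set x := log_base gamma^-1 (w / eps).
have x0 : 0 < x by rewrite divr_gt0.
have c0 : 0 < Num.ceil x by rewrite ceil_gt0.
have KE : (K_eps gamma w eps)%:R = (Num.ceil x)%:~R :> R.
  by rewrite /K_eps -/x -[in RHS](gtz0_abs c0).
split; first by rewrite /K_eps absz_gt0 gt_eqF.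
set n := K_eps gamma w eps in KE *.
rewrite -ler_pdivlMr// -[gamma]lnK ?posrE// -expRM_natl.
rewrite -[leRHS]lnK ?posrE ?divr_gt0// ler_expR.
have -> : ln (eps / w) = - ln (w / eps).
  by rewrite -lnV ?posrE ?divr_gt0// invf_div.
have -> : ln gamma = - ln gamma^-1 by rewrite lnV ?posrE// opprK.
rewrite mulrN lerN2 KE.
have -> : ln (w / eps) = x * ln gamma^-1 by rewrite /x /log_base divfK// gt_eqF.
by rewrite ler_wpM2r ?(ltW L0)// ceil_ge.
Qed.

Lemma bigmine_le (R : realType) (F : nat -> \bar R) n j : (j < n)%N ->
  (\big[mine/+oo]_(0 <= k < n) F k <= F j)%E.
Proof. by move=> jn; rewrite big_mkord; exact: (bigmin_le _ (Ordinal jn)). Qed.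

Theorem theorem6p3 (R : realType) (disp : measure_display)
  (T : measurableType disp) (P : probability T R)
  (d N : nat) (d_gt0 : (0 < d)%N) (N_gt0 : (0 < N)%N)
  (* objective function *)
  (f : 'rV[R]_d -> R) (f_ge0 : forall x, 0 <= f x)
  (Lf : R) (Lf_gt0 : 0 < Lf)
  (f_lip : forall x y, `|f x - f y| <= Lf * enorm (x - y))
  (xs : 'rV[R]_d) (xs_min : forall x, f xs <= f x)
  (xs_uniq : forall z, (forall x, f z <= f x) -> z = xs)
  (finf R0 nu mu : R)
  (finf_gt0 : 0 < finf) (R0_gt0 : 0 < R0) (nu_gt0 : 0 < nu) (mu_gt0 : 0 < mu)
  (f_growth : forall x, cball xs R0 x ->
     mu * enorm (x - xs) <= (f x - f xs) `^ nu)
  (f_far : forall x, ~ cball xs R0 x -> finf < f x - f xs)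
  (* parameters of the algorithm *)
  (lambda delta sigma : R) (alpha : nat -> R)
  (lambda_gt0 : 0 < lambda) (delta_ge0 : 0 <= delta) (sigma_gt0 : 0 < sigma)
  (alpha_ge0 : forall k, 0 <= alpha k)
  (Mg : R) (Mg_gt0 : 0 < Mg)
  (g_bound : forall x, enorm (fd_grad f sigma x) <= Mg)
  (* coordinates of the initial points and of the noise *)
  (x0 : 'I_N -> 'I_d -> {RV P >-> R}) (eta : nat -> 'I_d -> {RV P >-> R})
  (eta_law : forall k l A, measurable A ->
     distribution P (eta k l) A = centered_gauss delta A)
  (eta_indep :
     mutually_independent (fun kl : nat * 'I_d => eta kl.1 kl.2))
  (x0_eta_indep : independent_systems P
     (sigma_family (fun il : 'I_N * 'I_d => x0 il.1 il.2))
     (sigma_family (fun kl : nat * 'I_d => eta kl.1 kl.2)))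
  (xi : R) (xi_gt0 : 0 < xi) (xi_lt1 : xi < 1)
  (gap_gt0 : 0 < gap lambda delta)
  (gamma_gt0 : 0 < rate xi lambda delta) (gamma_lt1 : rate xi lambda delta < 1)
  (eps : R) (eps_gt0 : 0 < eps) :
  let gamma := rate xi lambda delta in
  let X beta k w : 'I_N -> 'rV[R]_d :=
    escbo f beta lambda sigma alpha
      (fun i => \row_l x0 i l w) (fun j => \row_l eta j l w) k in
  let EW beta k : \bar R := 'E_P[fun w => mean_sqdist xs (X beta k w)]%E in
  let EX beta k : \bar R :=
    'E_P[fun w => (enorm (consensus f beta (X beta k w) - xs) ^+ 2)%R]%E in
  let EW0 : \bar R :=
    'E_P[fun w => mean_sqdist xs (fun i => \row_l x0 i l w)]%E in
  let C4 beta k : R := kappa xi lambda delta * Num.sqrt (fine (EW beta k)) in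
  let q beta k : R := q_level finf mu nu (C4 beta k) in
  let r beta k : R := r_radius f xs R0 (q beta k) in
  let K beta : \bar R := horizon eps (C4 beta) (EW beta) (EX beta) in
  (eps%:E < EW0)%E -> (EW0 < +oo)%E ->
  exists2 beta0 : R, 0 < beta0 &
    forall beta : R, beta0 < beta ->
      (forall k : nat, ((k%:R : R)%:E < K beta)%E ->
         alpha k * Mg <= kappa xi lambda delta * Num.sqrt eps) ->
      (forall n : nat, K beta = (n%:R : R)%:E ->
         \forall w \ae P,
           particles_in_ball xs (r beta n) (X beta n w) !=set0) ->
      (\big[mine/+oo]_(0 <= k < (K_eps gamma (fine EW0) eps).+1) EW beta k
         <= eps%:E)%E
      /\
      (forall k : nat, (0 < k)%N ->
         (forall j : nat, (j < k)%N -> (eps%:E < EW beta j)%E) ->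
         (EW beta k < (gamma ^+ k)%:E * EW0)%E).
Proof.
move=> gamma X EW EX EW0 C4 q r K eps_lt_EW0 EW0_fin.
set s := lambda ^+ 2 + delta ^+ 2.
set kap := kappa xi lambda delta.
have kap_gt0 : 0 < kap by exact: kappa_gt0.
have lam1 : lambda <= 1 by apply/ltW; exact: lambda_lt1 gap_gt0.
have s_le : s <= lambda by move: gap_gt0; rewrite /gap /s; lra.
have contr := kappa_contraction xi_gt0 lambda_gt0 gap_gt0.
pose W beta k w := mean_sqdist xs (X beta k w).
pose E beta k w := enorm (consensus f beta (X beta k w) - xs) ^+ 2.
have EWE beta k : EW beta k = (\int[P]_w (W beta k w)%:E)%E by rewrite /EW unlock.
have EXE beta k : EX beta k = (\int[P]_w (E beta k w)%:E)%E by rewrite /EX unlock.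
have W_ge0 beta k w : 0 <= W beta k w by exact: mean_sqdist_ge0.
have EW_ge0 beta k : (0 <= EW beta k)%E by rewrite EWE; apply: integral_ge0 => w _; rewrite lee_fin.
have EW_0 beta : EW beta 0%N = EW0 by [].
pose x0' (il : 'I_N * 'I_d) := x0 il.1 il.2.
have mW beta k : measurable_fun setT (W beta k).
  exact: (measurable_mean_sqdist (Lf := Lf)).
have iW0 beta : P.-integrable setT (EFin \o W beta 0%N).
  apply/integrableP; split; first exact/measurable_EFinP.
  under eq_integral do rewrite gee0_abs ?lee_fin//.
  by rewrite -EWE.
have EW0_finnum : EW0 \is a fin_num.
  by rewrite -(EW_0 0) ge0_fin_numE.
(* A lower bound, uniform in [beta] and [k], for [q beta k] as long as [E[W_k] > eps]. *)
pose q0 := q_level finf mu nu (kap * Num.sqrt eps).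
have q0_gt0 : 0 < q0 by apply: q_level_gt0 => //; rewrite mulr_gt0// sqrtr_gt0.
have N0 : 0 < N%:R :> R by rewrite ltr0n.
(* Chosen so that [beta * q0 > 2 * N / kap ^+ 2]; then [expR (- t) <= t^-1] yields [exp_small]. *)
exists (2 * N%:R / kap ^+ 2 / q0).
  by rewrite divr_gt0// divr_gt0 ?exprn_gt0// mulr_gt0.
move=> beta beta_gt alpha_small particle.
have beta_ge0 : 0 <= beta.
  apply: le_trans (ltW beta_gt).
  by rewrite divr_ge0 ?(ltW q0_gt0)// divr_ge0 ?sqr_ge0.
have exp_small C : kap * Num.sqrt eps <= C ->
    expR (- beta * q_level finf mu nu C) * N%:R <= kap ^+ 2 / 2.
  move=> leC; set ql := q_level finf mu nu C.
  have q0_le : q0 <= ql.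
    by apply: le_q_level => //; rewrite mulr_ge0 ?sqrtr_ge0// ltW.
  have k2 : 0 < kap ^+ 2 by rewrite exprn_gt0.
  have t_gt : 2 * N%:R / kap ^+ 2 < beta * ql.
    apply: (@lt_le_trans _ _ (beta * q0)); first by rewrite -ltr_pdivrMr.
    by rewrite ler_wpM2l.
  have t_gt0 : 0 < beta * ql.
    by apply: lt_trans t_gt; rewrite divr_gt0// mulr_gt0.
  rewrite mulNr expRN; apply: (@le_trans _ _ ((beta * ql)^-1 * N%:R)).
    rewrite ler_wpM2r// lef_pV2 ?posrE ?expR_gt0//.
    by apply: le_trans (expR_ge1Dx _); rewrite lerDr.
  rewrite mulrC ler_pdivrMr//; move: t_gt; rewrite ltr_pdivrMr//; lra.
have C4_sqr k : C4 beta k ^+ 2 = kap ^+ 2 * fine (EW beta k).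
  by rewrite /C4 exprMn sqr_sqrtr// fine_ge0.
have EW_fin k : P.-integrable setT (EFin \o W beta k) -> EW beta k \is a fin_num.
  by move=> iW; rewrite EWE; exact: (integrable_fin_num measurableT iW).
(* Half of [C4 ^+ 2] comes from the particles below level [f xs + 2 * q], the other half from
   [exp_small], because [kap ^+ 2 * E[W_k] = C4 ^+ 2]. *)
have EX_le k : P.-integrable setT (EFin \o W beta k) -> (eps%:E < EW beta k)%E ->
    (\forall w \ae P, particles_in_ball xs (r beta k) (X beta k w) !=set0) ->
    (EX beta k <= (C4 beta k ^+ 2)%:E)%E.
  move=> iW eps_lt low.
  have EWk := fineK (EW_fin k iW).
  have eps_le : eps <= fine (EW beta k) by rewrite -lee_fin EWk ltW.
  have C4_ge : kap * Num.sqrt eps <= C4 beta k.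
    by rewrite /C4 ler_pM2l// ler_wsqrtr.
  have C4_gt0 : 0 < C4 beta k.
    by apply: lt_le_trans C4_ge; rewrite mulr_gt0// sqrtr_gt0.
  have q_ge0 : 0 <= q beta k by apply/ltW; exact: q_level_gt0.
  have M_ge0 : 0 <= C4 beta k ^+ 2 / 2 by rewrite divr_ge0// sqr_ge0.
  have fM x : f x <= f xs + q beta k + q beta k ->
      enorm (x - xs) ^+ 2 <= C4 beta k ^+ 2 / 2.
    exact: (sublevel_ball nu_gt0 mu_gt0 xs_min f_growth f_far (ltW C4_gt0)).
  have low' : \forall w \ae P, exists i, f (X beta k w i) <= f xs + q beta k.
    apply: filterS low => w.
    exact: (particle_below_level (ltW Lf_gt0) f_lip q_ge0).
  have := mean_consensus_laplace N_gt0 Lf_gt0 f_lip beta_ge0 M_ge0 fM low' iW.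
  rewrite -EXE -EWE -EWk -EFinM -EFinD => /le_trans; apply.
  rewrite lee_fin; have := exp_small _ C4_ge; rewrite -/(q beta k) => small.
  have := ler_wpM2r (le_trans (ltW eps_gt0) eps_le) small.
  by have := C4_sqr k; lra.
pose A := 1 - 2 * lambda + s + (1 - s) * kap.
pose B := (lambda - s) / kap + lambda + s.
pose D := (1 - lambda) / kap + lambda + 1.
have B_ge0 : 0 <= B.
  rewrite /B !addr_ge0 ?sqr_ge0// ?divr_ge0 ?subr_ge0 ?(ltW kap_gt0) ?(ltW lambda_gt0)//.
have D_ge0 : 0 <= D.
  rewrite /D !addr_ge0// ?divr_ge0 ?subr_ge0 ?(ltW kap_gt0) ?(ltW lambda_gt0)//.
(* Both the consensus error and [(alpha k * Mg) ^+ 2] are at most [kap ^+ 2 * E[W_k]], so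
   [kappa_contraction] applies. *)
have step k : P.-integrable setT (EFin \o W beta k) -> (eps%:E < EW beta k)%E ->
    (EX beta k <= (C4 beta k ^+ 2)%:E)%E ->
    alpha k * Mg <= kap * Num.sqrt eps ->
    P.-integrable setT (EFin \o W beta k.+1) /\
    (EW beta k.+1 < gamma%:E * EW beta k)%E.
  move=> iW eps_lt EXk alphaM.
  have [iW' stepE] := escbo_step N_gt0 Lf_gt0 f_lip g_bound eta_law eta_indep
    x0_eta_indep iW kap_gt0 s_le lam1 (ltW lambda_gt0).
  split => //; apply: (@le_lt_trans _ _ (A%:E * EW beta k + B%:E * EX beta k
    + (D * (alpha k * Mg) ^+ 2)%:E)%E).
    by rewrite !EWE EXE; exact: stepE.
  have EWk := fineK (EW_fin k iW).
  have eps_le : eps <= fine (EW beta k) by rewrite -lee_fin EWk ltW.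
  have w_gt0 := lt_le_trans eps_gt0 eps_le.
  have aM2 : (alpha k * Mg) ^+ 2 <= kap ^+ 2 * fine (EW beta k).
    apply: (@le_trans _ _ (kap ^+ 2 * eps)).
      rewrite -[X in _ <= _ * X](sqr_sqrtr (ltW eps_gt0)) -[leRHS]exprMn.
      have aM0 : 0 <= alpha k * Mg by rewrite mulr_ge0// ltW.
      by rewrite ler_pXn2r ?nnegrE// (le_trans aM0 alphaM).
    by rewrite ler_wpM2l// sqr_ge0.
  rewrite C4_sqr in EXk.
  move: (fine (EW beta k)) EWk eps_le w_gt0 aM2 EXk => v <- eps_le v_gt0 aM2 EXk.
  apply: (@le_lt_trans _ _
      (A%:E * v%:E + B%:E * (kap ^+ 2 * v)%:E + (D * (kap ^+ 2 * v))%:E)%E).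
    apply: leeD; first by rewrite leeD2l// lee_wpmul2l// lee_fin.
    by rewrite lee_fin ler_wpM2l.
  have : (A + B * kap ^+ 2 + D * kap ^+ 2) * v < gamma * v by rewrite ltr_pM2r.
  by rewrite -!EFinM -!EFinD lte_fin !mulrDl -!mulrA.
(* The consensus bound and integrability are carried along the induction; the non-strict decay is
   listed separately because the strict one fails at [k = 0]. *)
have main k : (forall j, (j < k)%N -> (eps%:E < EW beta j)%E) ->
    [/\ forall j, (j < k)%N -> (EX beta j <= (C4 beta j ^+ 2)%:E)%E,
        P.-integrable setT (EFin \o W beta k),
        (EW beta k <= (gamma ^+ k)%:E * EW0)%E &
        (0 < k)%N -> (EW beta k < (gamma ^+ k)%:E * EW0)%E].
  elim: k => [|k IH] epsk.
    by split => //; rewrite expr0 mul1e EW_0.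
  have [EXj iWk EWk _] := IH (fun j jk => epsk j (ltnW jk)).
  have epsEWk := epsk k (ltnSn k).
  have EXk : (EX beta k <= (C4 beta k ^+ 2)%:E)%E.
    (* If the bound failed at [k], this would be the first bad index, hence [K beta = k]; the
       particle hypothesis at the horizon would then give the bound. *)
    apply: contrapT => nEXk; apply: (nEXk); apply: EX_le => //.
    apply: particle; apply: horizon_eq => [j jk|[_ /nEXk]//].
    by split; [exact/epsk/ltnW|exact: EXj].
  have good j : (j <= k)%N ->
      (eps%:E < EW beta j)%E /\ (EX beta j <= (C4 beta j ^+ 2)%:E)%E.
    rewrite leq_eqVlt => /predU1P[->//|jk].
    by split; [exact/epsk/ltnW|exact: EXj].
  (* Good indices up to [k] included put [k] strictly below the horizon, where the step-size
     condition is available. *)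
  have [iWk1 EWk1] := step k iWk epsEWk EXk (alpha_small k (lt_horizon good)).
  have lt1 : (EW beta k.+1 < (gamma ^+ k.+1)%:E * EW0)%E.
    apply: (lt_le_trans EWk1).
    by rewrite exprS EFinM -muleA lee_pmul2l.
  split => // [j|]; last exact: ltW.
  by rewrite ltnS => /good[].
split; last by move=> k k0 epsk; have [_ _ _] := main k epsk; exact.
(* If accuracy were missed at all indices up to [K_eps], strict decay at [K_eps] would give [E[W] <
   eps] there. *)
rewrite leNgt; apply/negP => eps_lt.
have [Kpos Kle] : (0 < K_eps gamma (fine EW0) eps)%N /\
    gamma ^+ K_eps gamma (fine EW0) eps * fine EW0 <= eps.
  by apply: K_eps_spec => //; rewrite -lte_fin fineK.
have big j : (j < (K_eps gamma (fine EW0) eps).+1)%N -> (eps%:E < EW beta j)%E.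
  by move=> jK; apply: lt_le_trans eps_lt _; exact: bigmine_le.
have [_ _ _ /(_ Kpos) lt_EW] := main _ (fun j jK => big j (ltnW jK)).
have : (eps%:E < eps%:E)%E; last by rewrite ltxx.
apply: (lt_trans (big _ (ltnSn _))); apply: (lt_le_trans lt_EW).
by rewrite -[X in (_ * X)%E](fineK EW0_finnum) -EFinM lee_fin.
Qed.
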